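(* Let $w$ be a weight on $\mathbb{R}^N$ with $\|w\|_{A_2}<\infty$ and let $\sigma:=w^{-1}$. Let $S=\sum_{K\in\mathscr{D}}A_K$ be a good, finite, bounded dyadic shift with parameters $(u,v)$. Then $$\|S(w1_Q)\|_{L^2(\sigma)}\le C\,2^{\max(u,v)\gamma N/2}\,uv\,\|w\|_{A_2}\,w(Q)^{1/2}$$ for all cubes $Q\subset\mathbb{R}^N$. If $Q\in\mathscr{D}$, the estimate holds without the factor $2^{\max(u,v)\gamma N/2}$. The constant $C$ depends only on $N$, $\alpha$ and the constant $C_0$ in the definition of a bounded dyadic shift; in particular it is independent of $u,v$, $w$, $Q$, $\mathscr{D}$, and the number of nonzero $A_K$.
   Context: A weight is a function $w\in L^1_{\mathrm{loc}}(\mathbb{R}^N)$, positive a.e.; $w(Q):=\int_Qw\,dx$; $\|w\|_{A_2}:=\sup_Q\frac1{|Q|}\int_Qw\cdot\frac1{|Q|}\int_Qw^{-1}$ over all cubes $Q$; $L^2(\sigma)$ is the $L^2$ space of $\sigma\,dx$. Fixed parameters: $\alpha\in(0,1]$ and $\gamma:=\frac{\alpha}{2(N+\alpha)}$. Dyadic systems: with $\mathscr{D}^0:=\bigcup_{k\in\mathbb{Z}}\{2^{-k}([0,1)^N+m'):m'\in\mathbb{Z}^N\}$ and $\beta=(\beta_j)_{j\in\mathbb{Z}}\in(\{0,1\}^N)^{\mathbb{Z}}$, a dyadic system is a collection $\mathscr{D}=\mathscr{D}^\beta:=\{I+\sum_{j:2^{-j}<\ell(I)}\beta_j2^{-j}:I\in\mathscr{D}^0\}$,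 where $\ell(I)$ is the side length of $I$. The cube $Q$ is arbitrary and need not belong to $\mathscr{D}$. Haar functions: for each dyadic cube $I$, $h^\eta_I$, $\eta\in\{0,1\}^N$, are fixed functions supported in $I$, constant on each of the $2^N$ dyadic children of $I$, with $\|h_I^\eta\|_\infty\le c_N|I|^{-1/2}$, $\int h^\eta_Ih^\theta_I\,dx=\delta_{\eta\theta}$, and $h^0_I:=|I|^{-1/2}1_I$. A dyadic shift with parameters $(u,v)$ (nonnegative integers) is an operator $S=\sum_{K\in\mathscr{D}}A_K$, where $\mathscr{D}$ is a dyadic system, $A_Kf(x)=\frac1{|K|}\int_Ka_K(x,y)f(y)\,dy$, $\|a_K\|_\infty\le C_0$ for a fixed constant $C_0$, and $$a_K(x,y)=\sum_{\substack{I\in\mathscr{D};\,I\subseteq K\\ \ell(I)=2^{-u}\ell(K)}}\ \sum_{\substack{J\in\mathscr{D};\,J\subseteq K\\ \ell(J)=2^{-v}\ell(K)}}\ \sum_{\eta,\theta\in\{0,1\}^N}a^{\eta\theta}_{IJK}\,h^\theta_J(x)\,h^\eta_I(y)$$ with scalar coefficients $a^{\eta\theta}_{IJK}$. The shift is finite if only finitely many $A_K$ are nonzero; bounded if $\|Sf\|_{L^2}\le C_0\|f\|_{L^2}$ for all $f\in L^2(\mathbb{R}^N)$ (unweighted); and good if $\operatorname{dist}(J,\partial K)\ge\tfrac12\ell(J)^\gamma\ell(K)^{1-\gamma}$ and $\operatorname{dist}(I,\partial K)\ge\tfrac12\ell(I)^\gamma\ell(K)^{1-\gamma}$ for all $I,J,K$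 for which some $a^{\eta\theta}_{IJK}$ is nonzero. *)

(* Defs.v *)
From HB Require Import structures.
From mathcomp Require Import all_boot all_order all_algebra finmap.
From mathcomp Require Import all_classical all_reals all_analysis.

Set Implicit Arguments.
Unset Strict Implicit.
Unset Printing Implicit Defensive.

Import Order.TTheory GRing.Theory Num.Theory.
Import numFieldNormedType.Exports.

Local Open Scope classical_set_scope.
Local Open Scope ring_scope.

(* R^n is 'rV[R]_n, with its Borel sigma-algebra presented as the product     *)
(* sigma-algebra (generated by the coordinates).                              *)

Section measurable_rV.
Variables (R : realType) (n : nat).

Let coord (i : 'I_n) (x : 'rV[R]_n) : R := x ord0 i.

Let rV_set0 : g_sigma_preimage coord set0.
Proof. exact: sigma_algebra0. Qed.

Let rV_setC A : g_sigma_preimage coord A -> g_sigma_preimage coord (~` A).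
Proof. exact: sigma_algebraC. Qed.

Let rV_bigcup (F : (set 'rV[R]_n)^nat) :
  (forall i, g_sigma_preimage coord (F i)) ->
  g_sigma_preimage coord (\bigcup_i F i).
Proof. exact: sigma_algebra_bigcup. Qed.

HB.instance Definition _ := @isMeasurable.Build default_measure_display
  'rV[R]_n (g_sigma_preimage coord) rV_set0 rV_setC rV_bigcup.

Lemma measurable_fun_rVP d (T : measurableType d) (f : T -> 'rV[R]_n) :
  measurable_fun setT f <->
  forall i, measurable_fun setT (fun x => f x ord0 i).
Proof.
apply: (@iff_trans _ (g_sigma_preimage (fun i => coord i \o f) `<=` measurable)).
  rewrite g_sigma_preimage_comp; split=> [mf A [/= C preC <-]|prefS].
    exact: mf.
  by move=> _ A mA; apply: prefS; exists A.
split=> [fS i|mf].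
- move=> _ A mA; apply: fS; apply: sub_sigma_algebra.
  rewrite -bigcup_seq; exists i => /=; first by rewrite mem_index_enum.
  by exists A.
- apply: smallest_sub; first exact: sigma_algebra_measurable.
  rewrite -bigcup_seq; apply: bigcup_sub => i _ A [B mB <-].
  exact: mf.
Qed.

Lemma measurable_rV_coord (i : 'I_n) :
  measurable_fun setT (fun x : 'rV[R]_n => x ord0 i).
Proof. by move: i; apply/measurable_fun_rVP; exact: measurable_id. Qed.

End measurable_rV.

(* Lebesgue measure on R^n, by iterated products.                             *)

Section rV_cons_measure.
Variables (R : realType) (n : nat).

Definition rV_cons (p : measurableTypeR R * 'rV[R]_n) : 'rV[R]_n.+1 :=
  row_mx (const_mx p.1 : 'rV[R]_1) p.2.

Lemma measurable_rV_cons : measurable_fun setT rV_cons.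
Proof.
apply/measurable_fun_rVP => i; rewrite /rV_cons.
have [j|j] := @split_ordP 1 n i => ->.
  rewrite (_ : (fun _ => _) = fst); first exact: measurable_fst.
  by apply/funext => x; rewrite [LHS](@row_mxEl R 1 1 n) mxE.
rewrite (_ : (fun _ => _) = (fun x : 'rV[R]_n => x ord0 j) \o snd).
  apply: measurableT_comp; first exact: measurable_rV_coord.
  exact: measurable_snd.
by apply/funext => x; rewrite [LHS](@row_mxEr R 1 1 n).
Qed.

Definition rV_uncons (x : 'rV[R]_n.+1) : measurableTypeR R * 'rV[R]_n :=
  (x ord0 (lshift n ord0 : 'I_(1 + n)), \row_j x ord0 (rshift 1 j : 'I_(1 + n))).

Lemma rV_consK : cancel rV_cons rV_uncons.
Proof.
case=> a y; rewrite /rV_cons /rV_uncons /=; congr pair.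
  by rewrite [LHS](@row_mxEl _ 1 1 n) mxE.
by apply/rowP => j; rewrite mxE [LHS](@row_mxEr _ 1 1 n).
Qed.

Lemma measurable_rV_uncons : measurable_fun setT rV_uncons.
Proof.
apply: measurable_fun_pair; first exact: measurable_rV_coord.
apply/measurable_fun_rVP => j; under eq_fun do rewrite mxE.
exact: measurable_rV_coord.
Qed.

Variable mu : {sigma_finite_measure set 'rV[R]_n -> \bar R}.

Definition rV_cons_measure : set 'rV[R]_n.+1 -> \bar R :=
  pushforward (@lebesgue_measure R \x mu)%E rV_cons.

Let m : {measure set 'rV[R]_n.+1 -> \bar R} :=
  measure_function_pushforward__canonical__measure_function_Measure
    (@lebesgue_measure R \x mu)%E measurable_rV_cons.

Let rV_cons_measure0 : rV_cons_measure set0 = 0%E.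
Proof. exact: (measure0 m). Qed.

Let rV_cons_measure_ge0 A : (0 <= rV_cons_measure A)%E.
Proof. exact: (measure_ge0 m). Qed.

Let rV_cons_measure_sigma_additive : semi_sigma_additive rV_cons_measure.
Proof. exact: (@measure_semi_sigma_additive _ _ _ m). Qed.

HB.instance Definition _ := isMeasure.Build _ _ _ rV_cons_measure
  rV_cons_measure0 rV_cons_measure_ge0 rV_cons_measure_sigma_additive.

Let rV_cons_measure_sigma_finite : sigma_finite setT rV_cons_measure.
Proof.
have /sigma_finiteP[F [TF ndF Foo]] := sigma_finiteT (@lebesgue_measure R).
have /sigma_finiteP[G [TG ndG Goo]] := sigma_finiteT mu.
exists (fun k => rV_uncons @^-1` (F k `*` G k)).
  rewrite -preimage_bigcup (_ : \bigcup_k _ = setT) ?preimage_setT//.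
  rewrite -subTset => -[x y] _.
  have [i _ Fx] : (\bigcup_k F k) x by rewrite -TF.
  have [j _ Gy] : (\bigcup_k G k) y by rewrite -TG.
  exists (maxn i j) => //; split.
    by move: x Fx; exact/subsetPset/ndF/leq_maxl.
  by move: y Gy; exact/subsetPset/ndG/leq_maxr.
move=> k; have [mF Fk] := Foo k; have [mG Gk] := Goo k; split.
  by rewrite -[X in measurable X]setTI; apply: measurable_rV_uncons => //;
    exact: measurableX.
rewrite /rV_cons_measure /pushforward -comp_preimage.
rewrite (_ : _ \o _ = id) ?preimage_id; last first.
  by apply/funext => p; exact: rV_consK.
by rewrite product_measure1E// lte_mul_pinfty// ge0_fin_numE.
Qed.

HB.instance Definition _ := Measure_isSigmaFinite.Build _ _ _ rV_cons_measure
  rV_cons_measure_sigma_finite.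

End rV_cons_measure.

Fixpoint lebesgue_rV (R : realType) (n : nat) :
    {sigma_finite_measure set 'rV[R]_n -> \bar R} :=
  if n is n'.+1 then rV_cons_measure (lebesgue_rV R n') else \d_(0 : 'rV[R]_0).
Arguments lebesgue_rV {R n}.

Section weights.
Variables (R : realType) (N : nat).
Local Notation E := 'rV[R]_N.
Local Notation mu := (@lebesgue_rV R N).

(* The pair (c, l) stands for the cube c + [0, l)^N.                          *)
Definition cube := (E * R)%type.
Implicit Types Q I J K : cube.

Definition corner Q : E := Q.1.
Definition side Q : R := Q.2.

Definition cube_set Q : set E :=
  [set x | forall i, corner Q ord0 i <= x ord0 i < corner Q ord0 i + side Q].

Definition volume Q : R := fine (mu (cube_set Q)).

Definition locally_integrable_rV (f : E -> R) :=
  measurable_fun setT f /\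
  forall K : set E, compact K -> (\int[mu]_(x in K) `|f x|%:E < +oo)%E.

Definition weight (w : E -> R) :=
  locally_integrable_rV w /\ {ae mu, forall x, 0 < w x}.

Definition A2_norm (w : E -> R) : \bar R := ereal_sup
  [set (((volume Q)^-1%:E * \int[mu]_(x in cube_set Q) (w x)%:E) *
        ((volume Q)^-1%:E * \int[mu]_(x in cube_set Q) (w x)^-1%:E))%E
  | Q in [set Q | 0 < side Q]].

(* The norm of L^2(s dx). *)
Definition L2norm (s f : E -> R) : \bar R :=
  ((\int[mu]_x (`|f x| ^+ 2 * s x)%:E) `^ 2^-1)%E.

Definition in_L2 (f : E -> R) :=
  measurable_fun setT f /\ (L2norm (cst 1%R) f < +oo)%E.

Definition boundary (A : set E) : set E := closure A `\` interior A.

(* The norm of the library on 'rV[R]_N is the sup norm.                       *)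
Definition euclidean_norm (x : E) : R := Num.sqrt (\sum_i x ord0 i ^+ 2).

Definition set_dist (A B : set E) : R :=
  inf [set euclidean_norm (x - y) | x in A & y in B].

End weights.
Arguments volume {R N} Q.

Section dyadic.
Variables (R : realType) (N : nat).
Local Notation E := 'rV[R]_N.
Local Notation mu := (@lebesgue_rV R N).
Local Notation cube := (cube R N).
Implicit Types I J K : cube.

Definition standard_dyadic_system : set cube :=
  [set I | exists (k : int) (m : 'I_N -> int),
    I = (\row_i (2 ^ (- k) * (m i)%:~R), 2 ^ (- k))].

(* The sum of beta_j 2^-j over the integers j such that 2^-j < l.             *)
Definition dyadic_offset (beta : int -> 'I_N -> bool) (l : R) : E :=
  \row_i fine (\esum_(j in [set j : int | (2 ^ (- j) < l)%R])
                 ((beta j i)%:R * 2 ^ (- j))%:E)%E.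

Definition dyadic_system (beta : int -> 'I_N -> bool) : set cube :=
  [set (corner I + dyadic_offset beta (side I), side I)
  | I in standard_dyadic_system].

Definition haar_index := {ffun 'I_N -> bool}.

Definition child I (e : haar_index) : cube :=
  (\row_i (corner I ord0 i + (e i)%:R * (side I / 2)), side I / 2).

(* h eta is the Haar function h_I^eta of the cube I; c is the constant c_N.   *)
Definition haar_functions (c : R) I (h : haar_index -> E -> R) :=
  [/\ forall eta x, ~ cube_set I x -> h eta x = 0,
      forall eta e x y, cube_set (child I e) x -> cube_set (child I e) y ->
        h eta x = h eta y,
      forall eta x, `|h eta x| <= c * (Num.sqrt (volume I))^-1,
      forall eta theta,
        \int[mu]_x (h eta x * h theta x) = (eta == theta)%:R
    & h [ffun=> false] =
        fun x => (Num.sqrt (volume I))^-1 * \1_(cube_set I) x].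

Variable D : set cube.

Definition descendants (u : nat) K : set cube :=
  [set I | [/\ D I, cube_set I `<=` cube_set K & side I = 2 ^- u * side K]].

Variable h : cube -> haar_index -> E -> R.
Variables (u v : nat) (a : cube -> cube -> cube -> haar_index -> haar_index -> R).

(* a I J K eta theta is the coefficient a_{IJK}^{eta theta}; only its values  *)
(* at I in descendants u K and J in descendants v K matter.                   *)
Definition shift_kernel K (x y : E) : R :=
  \sum_(I \in descendants u K) \sum_(J \in descendants v K)
    \sum_(eta : haar_index) \sum_(theta : haar_index)
      a I J K eta theta * h J theta x * h I eta y.

Definition shift_component K (f : E -> R) (x : E) : R :=
  (volume K)^-1 * \int[mu]_(y in cube_set K) (shift_kernel K x y * f y).

(* The sum is finitely supported for a finite shift. *)
Definition dyadic_shift (f : E -> R) (x : E) : R :=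
  \sum_(K \in D) shift_component K f x.

Definition normalized_shift (C0 : R) :=
  forall K, D K -> forall x y, `|shift_kernel K x y| <= C0.

Definition finite_shift :=
  finite_set [set K | D K /\ shift_component K <> (fun _ _ => 0)].

Definition bounded_shift (C0 : R) :=
  forall f, in_L2 f ->
    (L2norm (cst 1%R) (dyadic_shift f) <= C0%:E * L2norm (cst 1%R) f)%E.

Definition good_shift (gamma : R) :=
  forall K I J, D K -> descendants u K I -> descendants v K J ->
    (exists eta theta, a I J K eta theta <> 0) ->
    2^-1 * side J `^ gamma * side K `^ (1 - gamma)
      <= set_dist (cube_set J) (boundary (cube_set K)) /\
    2^-1 * side I `^ gamma * side K `^ (1 - gamma)
      <= set_dist (cube_set I) (boundary (cube_set K)).

End dyadic.

(* Main.v *)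
Require Import Defs.
From HB Require Import structures.
From mathcomp Require Import all_boot all_order all_algebra finmap.
From mathcomp Require Import all_classical all_reals all_analysis.
From mathcomp Require Import measurable_realfun ring lra zify.

Set Implicit Arguments.
Unset Strict Implicit.
Unset Printing Implicit Defensive.

Import Order.TTheory GRing.Theory Num.Theory.
Import numFieldNormedType.Exports.

Local Open Scope classical_set_scope.
Local Open Scope ring_scope.

(** The shift is bounded by a positive bilinear maximal function, with a constant
linear in u + v, and the weighted estimate for the latter is elementary.

Write <f>_L for the average of f over a dyadic cube L.  For a bounded shift S
with parameters (u, v) and all f, g,

    | int S f . g | <= C (1 + u + v) int sup_(L containing x) <|f|>_L <|g|>_L dx

([pairing_domination]).  The proof is an induction on the size of a cube L
for the truncation of S to the cubes inside L.  Let P run over the maximal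
subcubes of L on which the average of |f| or of |g| exceeds four times its
average over L; by the weak type inequality they fill at most half of L.  Cubes
K inside some P are handled by induction.  For the others, replace f and g by
their averages on the cubes P.  The error f - <f>_P has mean zero on P, and
a_K(x, .) is constant on cubes of side 2^(-u-1) l(K), so only the u ancestors K
nearest to P see it; likewise for g and v.  The averaged functions are bounded
by multiples of <|f|>_L and <|g|>_L, and there the unweighted bound of S, which
passes to truncations, gives <|f|>_L <|g|>_L |L|.  This quantity is paid for by
the half of L outside the cubes P ([unstopped_half], [tree_step]).

For f = w 1_Q and g = sigma phi with phi = S f, each factor is an average of a
weight times a weighted average: <|f|>_L <|g|>_L is at most the A_2 constant
times M_w(1_Q) M_sigma(phi), where M_w and M_sigma are the weighted dyadic
maximal functions.  Since w sigma = 1, the integral of M_w(1_Q) M_sigma(phi) is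
at most the product of the norms of the factors in L^2(w) and L^2(sigma), and
the weighted Doob inequality ([doob_maximal]) finishes the proof
([shift_A2_bound]).  As C (1 + u + v) <= C' u v for u, v >= 1, this is the
claimed bound for every cube Q, dyadic or not.  When u or v is zero the claim is
S = 0, and this is what goodness gives: a cube touches its own boundary
([good_shift_degenerate]).

A finite shift is constant on all sufficiently small dyadic cubes, so the
argument above is carried out on the finite set of those cubes, called atoms.
Only the integrals of f, w and 1/w over the atoms matter
([dyadic_shift_atoms]). *)

(** * Blocks of a nested family of partitions, stopping times, and Doob's inequality *)

(** Points of the finite type X play the role of the smallest dyadic cubes; two
    points lie in the same block of level k when c k takes the same value at
    them, so that larger k means larger cubes. *)
Section Blocks.
Variables (R : realFieldType) (X : finType) (Y : eqType) (c : nat -> X -> Y).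
Implicit Types (f g h W : X -> R) (k l n : nat) (tau : X -> nat).

Hypothesis c_inj : injective (c 0).
Hypothesis c_nested : forall k x y, c k x = c k y -> c k.+1 x = c k.+1 y.

Lemma block_le k l x y : (k <= l)%N -> c k x = c k y -> c l x = c l y.
Proof.
move=> /subnK <-; elim: (l - k)%N => [|i IH] //= cxy.
by rewrite addSn; apply: c_nested; exact: IH.
Qed.

Definition block_sum k f x := \sum_(z | c k x == c k z) f z.

(** Stopping times, read from the largest level down: deciding whether to stop at
    a block only involves the blocks containing it. *)
Definition adapted tau := forall x y, c (tau x) x = c (tau x) y -> tau y = tau x.

Lemma adapted_sym tau x y : adapted tau ->
  (c (tau x) x == c (tau x) y) = (c (tau y) y == c (tau y) x).
Proof. by move=> tauA; apply/eqP/eqP => e; rewrite (tauA _ _ e). Qed.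

Lemma block_sum_eq k f x y : c k x = c k y -> block_sum k f x = block_sum k f y.
Proof. by rewrite /block_sum => ->. Qed.

Lemma block_sum0 f x : block_sum 0 f x = f x.
Proof.
rewrite /block_sum (big_pred1 x) // => y /=.
by apply/eqP/eqP => [/c_inj|->].
Qed.

Lemma ler_block_sum k f g x :
  (forall z, c k x = c k z -> f z <= g z) -> block_sum k f x <= block_sum k g x.
Proof. by move=> fg; apply: ler_sum => z /eqP /fg. Qed.

Lemma block_sum_ge0 k f x :
  (forall z, c k x = c k z -> 0 <= f z) -> 0 <= block_sum k f x.
Proof. by move=> f0; apply: sumr_ge0 => z /eqP /f0. Qed.

(** Summing over the block of a stopping time is a symmetric operator, since
    being in the same stopped block is a symmetric relation; every use of
    conditional expectations below rests on this. *)
Lemma block_sum_adj tau f g : adapted tau ->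
  \sum_y g y * block_sum (tau y) f y = \sum_y block_sum (tau y) g y * f y.
Proof.
move=> tauA; under eq_bigr do rewrite mulr_sumr big_mkcond.
rewrite exchange_big; apply: eq_bigr => z _ /=.
rewrite mulr_suml [RHS]big_mkcond; apply: eq_bigr => y _.
by rewrite adapted_sym.
Qed.

Lemma adapted_cst k : adapted (fun=> k).
Proof. by []. Qed.

Section Doob.
Variables (n : nat) (W f : X -> R).
Hypothesis W_gt0 : forall x, 0 < W x.

Lemma block_sum_gt0 k x : 0 < block_sum k W x.
Proof.
rewrite /block_sum (bigD1 x) //= ltr_pwDl //; apply: sumr_ge0 => z _.
exact: ltW.
Qed.

Definition mean k x := block_sum k (fun z => W z * f z) x / block_sum k W x.

(** The maximal function over the levels n, n - 1, ..., n - i. *)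
Fixpoint max_mean i x :=
  if i is j.+1 then Num.max (max_mean j x) (mean (n - j.+1) x) else mean n x.

Lemma mean_eq k x y : c k x = c k y -> mean k x = mean k y.
Proof. by move=> e; rewrite /mean !(block_sum_eq _ e). Qed.

Lemma max_mean_eq i x y : c (n - i) x = c (n - i) y -> max_mean i x = max_mean i y.
Proof.
elim: i => [|i IH] /=; first by rewrite subn0; exact: mean_eq.
move=> e; rewrite (mean_eq e) IH //; apply: block_le e.
by rewrite leq_sub2l.
Qed.

Lemma mean_le_max_mean k x : (k <= n)%N -> mean k x <= max_mean n x.
Proof.
move=> kn; have H i : (n - k <= i)%N -> mean k x <= max_mean i x.
  elim: i => [|i IH] /=.
    by rewrite leqn0 subn_eq0 => nk; rewrite (_ : k = n) //; apply/anti_leq/andP.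
  rewrite leq_eqVlt => /orP[/eqP e|]; last first.
    by rewrite ltnS => /IH /le_trans; apply; rewrite le_max lexx.
  by rewrite le_max -e subKn // lexx orbT.
by apply: H; rewrite leq_subr.
Qed.

(** The conditional expectation property, for the measure with density W. *)
Lemma sum_mean k s : (forall x y, c k x = c k y -> s x = s y) ->
  \sum_x W x * (s x * mean k x) = \sum_x W x * (s x * f x).
Proof.
move=> s_eq.
transitivity (\sum_x (W x * s x / block_sum k W x) *
                     block_sum k (fun z => W z * f z) x).
  by apply: eq_bigr => x _; rewrite /mean; ring.
rewrite (block_sum_adj _ _ (@adapted_cst k)); apply: eq_bigr => x _.
rewrite {1}/block_sum.
under eq_bigr => z /eqP e do rewrite -(s_eq _ _ e) -(block_sum_eq _ e) -mulrA.
rewrite -mulr_suml -/(block_sum k W x).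
by have := block_sum_gt0 k x; move=> ?; field; rewrite gt_eqF.
Qed.

(** Doob's maximal inequality.  With s the running maximum and x the current
    mean, 2 s ^ 2 - 4 s x is a supermartingale when passing from a block to its
    subblocks, it is nonpositive at the coarsest level where s = x, and it
    dominates s ^ 2 - 4 x ^ 2. *)
Lemma doob_maximal :
  \sum_x W x * max_mean n x ^+ 2 <= 4 * \sum_x W x * f x ^+ 2.
Proof.
pose U (x s : R) := 2 * s ^+ 2 - 4 * (s * x).
have step i : (i <= n)%N ->
    \sum_x W x * U (mean (n - i) x) (max_mean i x) <= 0.
  elim: i => [|i IH] lin.
    apply: sumr_le0 => x _; rewrite subn0 /= /U.
    rewrite mulr_ge0_le0 ?(ltW (W_gt0 _)) //.
    rewrite (_ : _ - _ = - 2 * mean n x ^+ 2); last by ring.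
    by rewrite mulr_le0_ge0 ?sqr_ge0 // oppr_le0.
  apply: le_trans (IH (ltnW lin)).
  apply: (@le_trans _ _ (\sum_x W x * U (mean (n - i.+1) x) (max_mean i x))).
    apply: ler_sum => x _; rewrite ler_pM2l //= /U.
    set s := max_mean i x; set y := mean _ x.
    have [ys|sy] := leP y s; first by [].
    by have := sqr_ge0 (y - s); nra.
  have splitU (m s : X -> R) : \sum_x W x * U (m x) (s x) =
      2 * \sum_x W x * s x ^+ 2 - 4 * \sum_x W x * (s x * m x).
    rewrite !mulr_sumr -sumrB; apply: eq_bigr => x _; rewrite /U; ring.
  rewrite !splitU lerD2l lerN2 ler_pM2l //.
  rewrite !sum_mean // => x y e; apply: max_mean_eq => //.
  by apply: block_le e; rewrite leq_sub2l.
rewrite -subr_le0 mulr_sumr -sumrB; apply: le_trans (step n (leqnn n)).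
rewrite subnn; apply: ler_sum => x _.
rewrite /mean !block_sum0 [W x * f x]mulrC mulfK ?gt_eqF // /U.
rewrite (_ : _ - _ = W x * (max_mean n x ^+ 2 - 4 * f x ^+ 2)); last by ring.
rewrite ler_pM2l //.
have := sqr_ge0 (max_mean n x - 2 * f x); nra.
Qed.

End Doob.

(** * Discrete shifts and their truncations *)

Section Shift.
Variables (d : R) (n : nat).
Hypothesis d_ge2 : 2 <= d.
Hypothesis block_card : forall k x, (k <= n)%N -> block_sum k (fun=> 1) x = d ^+ k.

Let d_gt0 : 0 < d. Proof. by apply: lt_le_trans d_ge2. Qed.
Let dX_gt0 k : 0 < d ^+ k. Proof. exact: exprn_gt0. Qed.
Let dX_neq0 k : d ^+ k != 0. Proof. by rewrite gt_eqF. Qed.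

Definition avg k f x := block_sum k f x / d ^+ k.

Lemma avg_eq k f x y : c k x = c k y -> avg k f x = avg k f y.
Proof. by move=> e; rewrite /avg (block_sum_eq _ e). Qed.

Lemma ler_avg k f g x : (forall z, c k x = c k z -> f z <= g z) ->
  avg k f x <= avg k g x.
Proof. by move=> fg; rewrite ler_pM2r ?invr_gt0 //; exact: ler_block_sum. Qed.

Lemma avg_ge0 k f x : (forall z, c k x = c k z -> 0 <= f z) -> 0 <= avg k f x.
Proof. by move=> f0; rewrite divr_ge0 ?(ltW (dX_gt0 _)) //; exact: block_sum_ge0. Qed.

Lemma avg_const k f x : (k <= n)%N -> (forall z, c k x = c k z -> f z = f x) ->
  avg k f x = f x.
Proof.
move=> kn fx; rewrite /avg /block_sum.
under eq_bigr => z /eqP /fx do [move=> ->; rewrite -[f x]mulr1].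
by rewrite -mulr_sumr -/(block_sum k (fun=> 1) x) block_card // mulfK.
Qed.

Lemma avg_le k f x M : (k <= n)%N -> (forall z, c k x = c k z -> f z <= M) ->
  avg k f x <= M.
Proof.
move=> kn fM; rewrite -[leRHS](@avg_const k (fun=> M) x) //.
exact: ler_avg.
Qed.

Lemma ler_norm_avg k f x : `|avg k f x| <= avg k (fun z => `|f z|) x.
Proof.
rewrite normrM normfV (ger0_norm (ltW (dX_gt0 _))).
by rewrite ler_pM2r ?invr_gt0 //; exact: ler_norm_sum.
Qed.

Lemma block_sum_avg k f x : block_sum k f x = avg k f x * d ^+ k.
Proof. by rewrite /avg divfK. Qed.

Lemma avg_child k f x : (forall z, 0 <= f z) -> avg k f x <= d * avg k.+1 f x.
Proof.
move=> f0; have -> : d * avg k.+1 f x = block_sum k.+1 f x / d ^+ k.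
  by rewrite /avg exprS; field; rewrite dX_neq0 gt_eqF.
rewrite /avg ler_pM2r ?invr_gt0 // /block_sum.
rewrite [leRHS]big_mkcond [leLHS]big_mkcond; apply: ler_sum => z _.
have [/c_nested ->|_] := eqVneq; first by rewrite eqxx.
by case: ifP.
Qed.

(** The conditional expectation property at a stopping time. *)
Lemma avg_adapted tau f g : adapted tau -> (forall x, tau x <= n)%N ->
  (forall y z, c (tau y) y = c (tau y) z -> g z = g y) ->
  \sum_y g y * avg (tau y) f y = \sum_y g y * f y.
Proof.
move=> tauA taun gA.
transitivity (\sum_y (g y / d ^+ tau y) * block_sum (tau y) f y).
  by apply: eq_bigr => y _; rewrite /avg; ring.
rewrite (block_sum_adj _ _ tauA); apply: eq_bigr => z _.
rewrite block_sum_avg avg_const // => [|y e]; last by rewrite (gA _ _ e) (tauA _ _ e).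
by rewrite divfK.
Qed.

Implicit Types a : nat -> X -> X -> R.

(** The sum of the A_K over the cubes K of level k. *)
Definition level_op a k f q := (\sum_(p | c k q == c k p) a k q p * f p) / d ^+ k.

(** Level 0 is left out because the kernels live on cubes strictly larger than
    the atoms; an atom therefore contributes nothing to the induction below. *)
Definition trunc_shift a l f q := \sum_(1 <= k < l.+1) level_op a k f q.

Definition pairing a l f g x := block_sum l (fun q => trunc_shift a l f q * g q) x.

Lemma eq_level_op a k f f' q : (forall p, c k q = c k p -> f p = f' p) ->
  level_op a k f q = level_op a k f' q.
Proof. by move=> ff; congr (_ / _); apply: eq_bigr => p /eqP /ff ->. Qed.

Lemma level_op_scale a k (t : R) f q :
  level_op a k (fun p => t * f p) q = t * level_op a k f q.
Proof.
rewrite /level_op mulrA mulr_sumr; congr (_ / _); apply: eq_bigr => p _.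
by rewrite mulrCA.
Qed.

Lemma eq_pairing a l f f' g g' x :
  (forall p, c l x = c l p -> f p = f' p) ->
  (forall p, c l x = c l p -> g p = g' p) ->
  pairing a l f g x = pairing a l f' g' x.
Proof.
move=> ff gg; apply: eq_bigr => q /eqP xq; rewrite gg //; congr (_ * _).
apply: eq_big_nat => k /andP[k1 kl]; apply: eq_level_op => p qp; apply: ff.
by rewrite xq; apply: block_le qp.
Qed.

Lemma pairing_scale a l (s t : R) f g x :
  pairing a l (fun p => s * f p) (fun p => t * g p) x = s * t * pairing a l f g x.
Proof.
rewrite /pairing /block_sum mulr_sumr; apply: eq_bigr => q _.
rewrite /trunc_shift mulr_suml [in RHS]mulr_suml mulr_sumr; apply: eq_bigr => k _.
by rewrite level_op_scale; ring.
Qed.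

Lemma geometric_tail l m : (l <= m)%N ->
  \sum_(l.+1 <= k < m.+1) d ^+ l / d ^+ k <= 1 - d ^+ l / d ^+ m.
Proof.
elim: m => [|m IH]; first by rewrite leqn0 => /eqP ->; rewrite big_geq // divff ?subrr.
rewrite leq_eqVlt => /orP[/eqP ->|]; first by rewrite big_geq // divff ?subrr.
rewrite ltnS => lm; rewrite big_nat_recr //=.
apply: le_trans (lerD (IH lm) (lexx _)) _.
rewrite exprS invfM; set r := d ^+ l / d ^+ m.
have r0 : 0 <= r by rewrite divr_ge0 ?(ltW (dX_gt0 _)).
rewrite (_ : d ^+ l * _ = r / d); last by rewrite /r; ring.
have : r / d <= r / 2 by rewrite ler_wpM2l // lef_pV2 ?posrE.
lra.
Qed.

Section KernelBound.
Variables (C0 : R) (a : nat -> X -> X -> R).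
Hypothesis a_le : forall k q p, `|a k q p| <= C0.
Hypothesis a_L2 : forall f, \sum_q trunc_shift a n f q ^+ 2 <= C0 ^+ 2 * \sum_q f q ^+ 2.

(** (C0 ^ 2 + 1) / 2 comes from the L^2 bound through 2 s t <= s ^ 2 + t ^ 2, and
    C0 from the geometric series over the cubes above a given block. *)
Definition L2_const := (C0 ^+ 2 + 1) / 2 + C0.

Lemma pairing_unit_bound l f g x : (l <= n)%N ->
  (forall p, c l x = c l p -> `|f p| <= 1) ->
  (forall p, c l x = c l p -> `|g p| <= 1) ->
  `|pairing a l f g x| <= L2_const * d ^+ l.
Proof.
move=> ln f1 g1.
pose f' p := if c l x == c l p then f p else 0.
(* Restricting f to the block, the levels up to l only see that block, and the
   full operator differs from them by the levels above l. *)
have -> : pairing a l f g x =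
    block_sum l (fun q => trunc_shift a n f' q * g q) x -
    block_sum l (fun q => (\sum_(l.+1 <= k < n.+1) level_op a k f' q) * g q) x.
  rewrite (@eq_pairing a l f f' g g x) // => [|p e]; last by rewrite /f' e eqxx.
  rewrite /block_sum -sumrB; apply: eq_bigr => q _.
  rewrite /trunc_shift [\sum_(1 <= k < n.+1) _](@big_cat_nat _ _ _ l.+1) //=.
  by rewrite mulrDl addrK.
apply: le_trans (ler_normB _ _) _; rewrite /L2_const mulrDl; apply: lerD.
  apply: le_trans (ler_norm_sum _ _ _) _.
  apply: (@le_trans _ _ (block_sum l (fun q => trunc_shift a n f' q ^+ 2 / 2 + 1 / 2) x)).
    apply: ler_sum => q /eqP /g1; rewrite normrM => gq.
    have := sqr_ge0 (`|trunc_shift a n f' q| - `|g q|).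
    have := normr_ge0 (g q); rewrite -[X in _ <= X / 2 + _]real_normK ?num_real //.
    nra.
  have -> : block_sum l (fun q => trunc_shift a n f' q ^+ 2 / 2 + 1 / 2) x =
     (block_sum l (fun q => trunc_shift a n f' q ^+ 2) x + d ^+ l) / 2.
    rewrite -(block_card x ln) /block_sum -big_split /= mulr_suml.
    by apply: eq_bigr => q _; rewrite mulrDl.
  have Sl : block_sum l (fun q => trunc_shift a n f' q ^+ 2) x <= C0 ^+ 2 * d ^+ l.
    apply: (@le_trans _ _ (\sum_q trunc_shift a n f' q ^+ 2)).
      rewrite /block_sum [leLHS]big_mkcond; apply: ler_sum => q _.
      by case: ifP; rewrite ?sqr_ge0.
    apply: le_trans (a_L2 _) _; rewrite ler_wpM2l ?sqr_ge0 //.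
    rewrite -(block_card x ln) /block_sum [leRHS]big_mkcond; apply: ler_sum => q _.
    rewrite /f'; case: eqP => [/f1 fq|_]; last by rewrite expr0n.
    rewrite -real_normK ?num_real //; have := normr_ge0 (f q); nra.
  by rewrite mulrAC ler_pM2r ?invr_gt0 //; lra.
apply: le_trans (ler_norm_sum _ _ _) _.
rewrite -(block_card x ln) /block_sum mulr_sumr; apply: ler_sum => q /eqP xq.
rewrite mulr1 normrM -[leRHS]mulr1; apply: ler_pM => //; last exact: g1.
have C0_ge0 : 0 <= C0 by exact: le_trans (a_le 0 x x).
apply: le_trans (ler_norm_sum _ _ _) _.
apply: (@le_trans _ _ (\sum_(l.+1 <= k < n.+1) C0 * (d ^+ l / d ^+ k))); last first.
  rewrite -mulr_sumr -[leRHS]mulr1 ler_wpM2l //.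
  apply: le_trans (geometric_tail ln) _.
  by rewrite lerBlDr lerDl divr_ge0 // ltW.
apply: ler_sum_nat => k /andP[lk kn].
rewrite normrM normfV (ger0_norm (ltW (dX_gt0 _))) mulrA ler_pM2r ?invr_gt0 //.
apply: le_trans (ler_norm_sum _ _ _) _.
rewrite -(block_card x ln) /block_sum mulr_sumr big_mkcond [leRHS]big_mkcond.
apply: ler_sum => p _; rewrite /f' normrM.
have [xp|_] := eqVneq (c l x) (c l p); last by rewrite normr0 mulr0 if_same.
case: ifP => _; last by rewrite mulr1.
by apply: ler_pM => //; exact: f1.
Qed.

(** The truncated operators inherit boundedness from the full one: inside a
    block of level l, the cubes above that block contribute at most the sum of a
    geometric series. *)
Lemma pairing_bound l f g x (s t : R) : (l <= n)%N ->
  (forall p, c l x = c l p -> `|f p| <= s) ->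
  (forall p, c l x = c l p -> `|g p| <= t) ->
  `|pairing a l f g x| <= L2_const * s * t * d ^+ l.
Proof.
move=> ln fs gt.
have s0 : 0 <= s by apply: le_trans (fs x erefl).
have t0 : 0 <= t by apply: le_trans (gt x erefl).
have unit (h : X -> R) (r : R) p : 0 <= r -> `|h p| <= r ->
    `|h p / r| <= 1 /\ h p = r * (h p / r).
  move=> r0 hr; have [r_eq0|r_neq0] := eqVneq r 0.
    move: hr; rewrite r_eq0 normr_le0 => /eqP ->.
    by rewrite invr0 mulr0 normr0 mul0r ler01.
  have rp : 0 < r by rewrite lt_neqAle eq_sym r_neq0.
  split; last by field.
  by rewrite normrM normfV (ger0_norm r0) ler_pdivrMr // mul1r.
rewrite (@eq_pairing a l f (fun p => s * (f p / s)) g (fun p => t * (g p / t))) => [| |].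
- rewrite pairing_scale normrM (ger0_norm (mulr_ge0 s0 t0)).
  rewrite [leRHS](_ : _ = s * t * (L2_const * d ^+ l)); last by ring.
  rewrite ler_wpM2l ?mulr_ge0 //; apply: pairing_unit_bound => // p e.
    by case: (unit f s p s0 (fs p e)).
  by case: (unit g t p t0 (gt p e)).
- by move=> p e; case: (unit f s p s0 (fs p e)).
- by move=> p e; case: (unit g t p t0 (gt p e)).
Qed.

End KernelBound.

(** * The part of the form above the stopped blocks *)

(** Where tau is 0 the block is a point, and the function is left unchanged. *)
Definition cond_exp tau f q := avg (tau q) f q.

(** The part of the pairing coming from the cubes strictly larger than the
    stopped block of their points. *)
Definition tree_form tau a l f g x :=
  \sum_(1 <= k < l.+1) \sum_(q | (c l x == c l q) && (tau q < k)%N)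
    level_op a k f q * g q.

(** The cubes above the stopped blocks form a well-defined family: if a block of
    level k were inside the stopped block of one of its points, it would be
    inside the stopped block of all of them. *)
Lemma adapted_lt tau k p q : adapted tau -> c k q = c k p ->
  (tau q < k)%N = (tau p < k)%N.
Proof.
move=> tauA; suff H r s : c k r = c k s -> (tau r < k)%N -> (tau s < k)%N.
  by move=> e; apply/idP/idP; apply: H.
move=> e rk; rewrite ltnNge; apply/negP => ks.
have e' : c (tau s) s = c (tau s) r by rewrite (block_le ks e).
by move: rk; rewrite (tauA _ _ e') ltnNge ks.
Qed.

Lemma tree_exchange tau k l x (F : X -> X -> R) : adapted tau -> (k <= l)%N ->
  \sum_(q | (c l x == c l q) && (tau q < k)%N) \sum_(p | c k q == c k p) F q p =
  \sum_(p | (c l x == c l p) && (tau p < k)%N) \sum_(q | c k p == c k q) F q p.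
Proof.
move=> tauA kl.
have sym (p q : X) : c k q = c k p ->
    (c l x == c l q) && (tau q < k)%N -> (c l x == c l p) && (tau p < k)%N.
  by move=> e /andP[/eqP -> qk]; rewrite (block_le kl e) eqxx -(adapted_lt tauA e).
rewrite (exchange_big_dep (fun p => (c l x == c l p) && (tau p < k)%N)) /=; last first.
  by move=> q p Hq /eqP e; exact: sym Hq.
apply: eq_bigr => p Hp; apply: eq_bigl => q; apply/andP/eqP => [[_ /eqP ->] //|e].
by split; [exact: sym Hp|rewrite e].
Qed.

Definition transpose a k q p := a k p q : R.

(** The roles of f and g, hence of u and v, can be exchanged. *)
Lemma tree_form_transpose tau a l f g x : adapted tau ->
  tree_form tau a l f g x = tree_form tau (transpose a) l g f x.
Proof.
move=> tauA; apply: eq_big_nat => k /andP[_ kl].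
rewrite /level_op /transpose.
under eq_bigr => q _ do rewrite mulrAC !mulr_suml.
under [RHS]eq_bigr => q _ do rewrite mulrAC !mulr_suml.
rewrite (tree_exchange _ _ tauA) //; apply: eq_bigr => p _.
by apply: eq_bigr => q _; ring.
Qed.

Lemma level_op_sub a k f f' q :
  level_op a k (fun p => f p - f' p) q = level_op a k f q - level_op a k f' q.
Proof.
rewrite /level_op -mulrBl -sumrB; congr (_ / _).
by apply: eq_bigr => p _; rewrite mulrBr.
Qed.

Lemma tree_form_subl tau a l f f' g x :
  tree_form tau a l f g x =
  tree_form tau a l (fun p => f p - f' p) g x + tree_form tau a l f' g x.
Proof.
rewrite /tree_form -big_split; apply: eq_bigr => k _ /=.
rewrite -big_split; apply: eq_bigr => q _ /=.
by rewrite level_op_sub -mulrDl subrK.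
Qed.

(** The cubes inside the stopped blocks are collected block by block; averaging
    over the stopped blocks turns a sum over them into a sum over points. *)
Lemma pairing_tree tau a l f g x : adapted tau -> (forall q, tau q <= l)%N ->
  (l <= n)%N ->
  pairing a l f g x = tree_form tau a l f g x +
    block_sum l (fun q => pairing a (tau q) f g q / d ^+ tau q) x.
Proof.
move=> tauA taul ln.
have -> : block_sum l (fun q => pairing a (tau q) f g q / d ^+ tau q) x =
    block_sum l (fun q => trunc_shift a (tau q) f q * g q) x.
  pose one_l q : R := if c l x == c l q then 1 else 0.
  have one_lE (h : X -> R) : block_sum l h x = \sum_q one_l q * h q.
    rewrite /block_sum big_mkcond; apply: eq_bigr => q _; rewrite /one_l.
    by case: ifP => _; rewrite ?mul1r ?mul0r.
  rewrite !one_lE.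
  rewrite -(avg_adapted (fun q => trunc_shift a (tau q) f q * g q) tauA); last 2 first.
  - by move=> q; exact: leq_trans (taul q) ln.
  - by move=> y z e; rewrite /one_l (block_le (taul y) e).
  apply: eq_bigr => q _; congr (_ * (_ / _)); apply: eq_bigr => p /eqP e.
  by rewrite (tauA _ _ e).
rewrite /tree_form (eq_bigr (fun k => \sum_(q | c l x == c l q)
   if (tau q < k)%N then level_op a k f q * g q else 0)); last first.
  by move=> k _; rewrite -big_mkcondr.
rewrite exchange_big /= -big_split /=; apply: eq_bigr => q _.
rewrite /trunc_shift (@big_cat_nat _ _ _ (tau q).+1) //=; last by rewrite ltnS.
rewrite mulrDl addrC; congr (_ + _).
rewrite [RHS](@big_cat_nat _ _ _ (tau q).+1) //=; last by rewrite ltnS.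
rewrite [X in _ = X + _]big_nat_cond [X in _ = X + _]big1 ?add0r; last first.
  by move=> k /andP[/andP[_]]; rewrite ltnS leqNgt => /negbTE ->.
rewrite mulr_suml; apply: eq_big_nat => k /andP[-> _] //.
Qed.

Lemma count_window (m l u : nat) :
  \sum_(1 <= k < l.+1 | (m < k <= m + u)%N) (1 : R) <= u%:R.
Proof.
rewrite big_const_seq /index_iota subn1 /= iter_addr_0 ler_nat -size_filter.
apply: (@leq_trans (size (iota m.+1 u))); last by rewrite size_iota.
apply: uniq_leq_size => [|k]; first by rewrite filter_uniq ?iota_uniq.
by rewrite mem_filter !mem_iota !addSn !ltnS => /andP[mku _].
Qed.

(** Functions of vanishing mean over the stopped blocks are only seen by the
    u levels just above those blocks: at higher levels the kernel is constant
    on the stopped block. *)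
Lemma tree_form_cancel tau a (C0 : R) (u : nat) l f g x (H : R) :
  (forall k q p, `|a k q p| <= C0) ->
  (forall k q p p', c k q = c k p -> c (k - u.+1) p = c (k - u.+1) p' ->
     a k q p = a k q p') ->
  adapted tau -> (forall q, tau q <= l)%N -> (l <= n)%N ->
  0 <= H ->
  (forall p k, c l x = c l p -> (tau p < k <= l)%N -> avg k (fun z => `|g z|) p <= H) ->
  `|tree_form tau a l (fun p => f p - cond_exp tau f p) g x| <=
     2 * C0 * u%:R * H * block_sum l (fun p => `|f p|) x.
Proof.
move=> a_le a_const tauA taul ln H0 gH.
have C0_ge0 : 0 <= C0 by exact: le_trans (a_le 0 x x).
have taun q : (tau q <= n)%N by exact: leq_trans (taul q) ln.
pose w k p : R := if (k <= tau p + u)%N then 2 * C0 * `|f p| else 0.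
have w_ge0 k p : 0 <= w k p by rewrite /w; case: ifP => // _; rewrite !mulr_ge0.
have inner k q : (tau q < k <= l)%N ->
    `|level_op a k (fun p => f p - cond_exp tau f p) q| <=
      (\sum_(p | c k q == c k p) w k p) / d ^+ k.
  move=> /andP[qk kl].
  rewrite /level_op normrM normfV (ger0_norm (ltW (dX_gt0 _))) ler_pM2r ?invr_gt0 //.
  pose al p := if c k q == c k p then a k q p else 0.
  (* Conditional expectation is symmetric, so it can be moved to the kernel. *)
  have -> : \sum_(p | c k q == c k p) a k q p * (f p - cond_exp tau f p) =
      \sum_p (al p - cond_exp tau al p) * f p.
    transitivity (\sum_p al p * f p - \sum_p al p * cond_exp tau f p).
      rewrite -sumrB big_mkcond; apply: eq_bigr => p _; rewrite /al -mulrBr.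
      by case: ifP; rewrite ?mul0r.
    under [RHS]eq_bigr do rewrite mulrBl.
    rewrite sumrB; congr (_ - _).
    transitivity (\sum_p (al p / d ^+ tau p) * block_sum (tau p) f p).
      by apply: eq_bigr => p _; rewrite /cond_exp /avg; ring.
    rewrite (block_sum_adj _ _ tauA); apply: eq_bigr => p _; congr (_ * _).
    rewrite /cond_exp /avg /block_sum mulr_suml; apply: eq_bigr => z /eqP e.
    by rewrite (tauA _ _ e).
  apply: le_trans (ler_norm_sum _ _ _) _.
  rewrite [leRHS]big_mkcond; apply: ler_sum => p _; rewrite normrM.
  have [qp|qp] := eqVneq (c k q) (c k p); last first.
    have -> : cond_exp tau al p = 0.
      rewrite /cond_exp /avg /block_sum big1 ?mul0r // => z /eqP e.
      rewrite /al; case: eqP => // qz; exfalso; move/eqP: qp; apply.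
      have zk : (tau z < k)%N by rewrite -(adapted_lt tauA qz).
      rewrite qz; apply/esym; apply: (@block_le (tau p)) => //.
      by rewrite -(tauA _ _ e) ltnW.
    by rewrite /al (negbTE qp) subrr normr0 mul0r.
  have pk : (tau p < k)%N by rewrite -(adapted_lt tauA qp).
  have in_block z : c (tau p) p = c (tau p) z -> al z = a k q z.
    by move=> e; rewrite /al qp (block_le (ltnW pk) e) eqxx.
  rewrite /w; case: leqP => [kp|pk2].
    rewrite ler_wpM2r // mulr2n mulrDl mul1r; apply: le_trans (ler_normB _ _) _.
    apply: lerD; first by rewrite in_block.
    apply: le_trans (ler_norm_avg _ _ _) _; apply: avg_le => // z e.
    by rewrite in_block.
  rewrite /cond_exp avg_const ?subrr ?normr0 ?mul0r // => z e.
  rewrite !in_block //; apply/esym/a_const => //.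
  apply: block_le e; rewrite leq_subRL ?addSn ?[(u + _)%N]addnC //.
  by rewrite (leq_ltn_trans _ pk2) // leq_addl.
apply: le_trans (ler_norm_sum _ _ _) _.
apply: (@le_trans _ _ (\sum_(1 <= k < l.+1)
    \sum_(p | (c l x == c l p) && (tau p < k)%N)
      w k p * avg k (fun z => `|g z|) p)).
  apply: ler_sum_nat => k /andP[_]; rewrite ltnS => kl.
  apply: le_trans (ler_norm_sum _ _ _) _.
  apply: (@le_trans _ _ (\sum_(q | (c l x == c l q) && (tau q < k)%N)
      \sum_(p | c k q == c k p) w k p * `|g q| / d ^+ k)).
    apply: ler_sum => q /andP[_ qk]; rewrite normrM -!mulr_suml mulrAC.
    by rewrite ler_wpM2r // inner // qk.
  rewrite (tree_exchange _ _ tauA) //; apply: ler_sum => p _.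
  by rewrite -mulr_suml -mulr_sumr mulrA.
rewrite (eq_bigr (fun k => \sum_(p | c l x == c l p)
   if (tau p < k)%N then w k p * avg k (fun z => `|g z|) p else 0)); last first.
  by move=> k _; rewrite -big_mkcondr.
rewrite exchange_big /= /block_sum mulr_sumr; apply: ler_sum => p /eqP xp.
apply: (@le_trans _ _ (\sum_(1 <= k < l.+1 | (tau p < k <= tau p + u)%N)
   2 * C0 * `|f p| * H)).
  rewrite [leRHS]big_mkcond; apply: ler_sum_nat => k /andP[_]; rewrite ltnS => kl.
  case: ifP => //= pk; rewrite /w; case: ifP => _; last by rewrite mul0r.
  by rewrite ler_wpM2l ?mulr_ge0 // gH // pk.
rewrite [leRHS](_ : _ = 2 * C0 * `|f p| * H * u%:R); last by ring.
under eq_bigr do rewrite -[_ * H]mulr1.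
by rewrite -mulr_sumr ler_wpM2l ?mulr_ge0 // count_window.
Qed.

(** * Domination by the bilinear maximal function *)

Section StoppingTime.
Variables (P : nat -> X -> bool) (l : nat).
Hypothesis P_eq : forall k x y, (k < l)%N -> c k x = c k y -> P k x = P k y.

(** The value is 0 also when P holds at no level; P (stopping_time x) x tells the
    two cases apart. *)
Definition stopping_time x := (\max_(k < l | P k x) k)%N.

Lemma stopping_time_lt x : (0 < l)%N -> (stopping_time x < l)%N.
Proof.
move=> l_gt0; rewrite -(prednK l_gt0) ltnS; apply/bigmax_leqP => k _.
by rewrite -ltnS prednK.
Qed.

Lemma stopping_time_max k x : (k < l)%N -> P k x -> (k <= stopping_time x)%N.
Proof. by move=> kl Pk; rewrite -[k]/(nat_of_ord (Ordinal kl)) leq_bigmax_cond. Qed.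

Lemma stopping_timeP k x : (k < l)%N -> P k x -> P (stopping_time x) x.
Proof.
move=> kl Pk; rewrite /stopping_time.
have [|i Pi ->] // := @eq_bigmax_cond _ [pred i : 'I_l | P i x] (@nat_of_ord l).
by apply/card_gt0P; exists (Ordinal kl).
Qed.

Lemma stopping_time_adapted : adapted stopping_time.
Proof.
move=> x y e; apply/anti_leq/andP; split; apply/bigmax_leqP => k Pk.
  rewrite leqNgt; apply/negP => xk.
  have Pkx : P k x by rewrite (@P_eq _ _ y) // (block_le (ltnW xk) e).
  by have := stopping_time_max (ltn_ord k) Pkx; rewrite leqNgt xk.
apply: leq_trans (stopping_time_max (ltn_ord k) Pk) _.
have tl : (stopping_time x < l)%N by exact/stopping_time_lt/(leq_ltn_trans _ (ltn_ord k)).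
by apply: stopping_time_max => //; rewrite -(P_eq tl e) (stopping_timeP (ltn_ord k)).
Qed.

End StoppingTime.

Section Domination.
Variables (C0 : R) (a : nat -> X -> X -> R) (u v : nat) (f g : X -> R).
Hypothesis a_le : forall k q p, `|a k q p| <= C0.
Hypothesis a_L2 : forall f, \sum_q trunc_shift a n f q ^+ 2 <= C0 ^+ 2 * \sum_q f q ^+ 2.
Hypothesis a_constr : forall k q p p', c k q = c k p ->
  c (k - u.+1) p = c (k - u.+1) p' -> a k q p = a k q p'.
Hypothesis a_constl : forall k q q' p, c k p = c k q ->
  c (k - v.+1) q = c (k - v.+1) q' -> a k q p = a k q' p.

Let absf p := `|f p|.
Let absg p := `|g p|.

Definition tree_const :=
  8 * C0 * u%:R + 8 * C0 * d * v%:R + 32 * d ^+ 2 * L2_const C0.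

Lemma tree_const_ge0 : 0 <= C0 -> 0 <= tree_const.
Proof.
have d0 := ltW d_gt0; move=> C0_ge0; rewrite /tree_const /L2_const.
by do ?[apply: addr_ge0 | apply: mulr_ge0 | apply: exprn_ge0]; rewrite ?invr_ge0 ?ler0n.
Qed.

Let avg_abs_ge0 h k x : 0 <= avg k (fun z => `|h z|) x.
Proof. exact: avg_ge0. Qed.

Section Local.
Variables (l : nat) (x : X).
Hypotheses (l_gt0 : (0 < l)%N) (ln : (l <= n)%N).

Let mf := avg l absf x.
Let mg := avg l absg x.

(** One level above the stopped block the average is still small, and passing to
    a child costs at most the factor d. *)
Lemma cond_exp_bound tau h p :
  (tau p < l)%N -> c l x = c l p ->
  avg (tau p).+1 (fun z => `|h z|) p <= 4 * avg l (fun z => `|h z|) x ->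
  `|cond_exp tau h p| <= 4 * d * avg l (fun z => `|h z|) x.
Proof.
move=> pl xp hp; apply: le_trans (ler_norm_avg _ _ _) _.
apply: le_trans (avg_child _ _ (fun z => normr_ge0 (h z))) _.
by rewrite [4 * d]mulrC -mulrA ler_pM2l.
Qed.

(** Calderon-Zygmund decomposition of both functions: the two error terms are
    seen by few levels, and on the averaged functions the form is the difference
    of truncations of the shift, each controlled by the L^2 bound. *)
Lemma tree_form_bound tau : adapted tau -> (forall q, tau q < l)%N ->
  (forall p k, c l x = c l p -> (tau p < k <= l)%N ->
    avg k absf p <= 4 * mf /\ avg k absg p <= 4 * mg) ->
  `|tree_form tau a l f g x| <= tree_const * mf * mg * d ^+ l.
Proof.
move=> tauA taul fg_le.
have taul' q : (tau q <= l)%N by exact: ltnW.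
have C0_ge0 : 0 <= C0 by exact: le_trans (a_le 0 x x).
have mf0 : 0 <= mf by exact: avg_abs_ge0.
have mg0 : 0 <= mg by exact: avg_abs_ge0.
pose Ef := cond_exp tau f; pose Eg := cond_exp tau g.
have Ef_le p : c l x = c l p -> `|Ef p| <= 4 * d * mf.
  move=> xp; apply: cond_exp_bound => //.
  by have [] := fg_le p (tau p).+1 xp; rewrite ?leqnn ?taul.
have Eg_le p : c l x = c l p -> `|Eg p| <= 4 * d * mg.
  move=> xp; apply: cond_exp_bound => //.
  by have [] := fg_le p (tau p).+1 xp; rewrite ?leqnn ?taul.
rewrite (tree_form_subl tau a l f Ef g x).
rewrite (tree_form_transpose _ _ Ef _ _ tauA) (tree_form_subl _ _ _ g Eg).
rewrite -[X in _ + (_ + X)](tree_form_transpose _ _ _ _ _ tauA).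
have bad1 : `|tree_form tau a l (fun p => f p - Ef p) g x| <=
    8 * C0 * u%:R * mf * mg * d ^+ l.
  apply: le_trans (@tree_form_cancel tau a C0 u l f g x (4 * mg)
    a_le a_constr tauA taul' ln _ _) _.
  - by rewrite mulr_ge0.
  - by move=> p k xp kl; case: (fg_le p k xp kl).
  by rewrite block_sum_avg -/mf; lra.
have bad2 : `|tree_form tau (transpose a) l (fun p => g p - Eg p) Ef x| <=
    8 * C0 * d * v%:R * mf * mg * d ^+ l.
  apply: le_trans (@tree_form_cancel tau (transpose a) C0 v l g Ef x (4 * d * mf)
    _ _ tauA taul' ln _ _) _.
  - by move=> k q p; exact: a_le.
  - by move=> k q p p' e1 e2; rewrite /transpose; apply: a_constl.
  - by rewrite mulr_ge0 // mulr_ge0 // ltW.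
  - move=> p k xp /andP[_ kl]; apply: avg_le => [|z pz]; first exact: leq_trans ln.
    by apply: Ef_le; rewrite xp (block_le kl pz).
  by rewrite block_sum_avg -/mg; lra.
have good : `|tree_form tau a l Ef Eg x| <=
    32 * d ^+ 2 * L2_const C0 * mf * mg * d ^+ l.
  have /(canRL (addrK _)) -> := esym (pairing_tree a Ef Eg x tauA taul' ln).
  have G m z : (m <= l)%N -> c l x = c l z ->
      `|pairing a m Ef Eg z| <= L2_const C0 * (4 * d * mf) * (4 * d * mg) * d ^+ m.
    move=> ml xz; apply: pairing_bound => //; first exact: leq_trans ln.
      by move=> p zp; apply: Ef_le; rewrite xz (block_le ml zp).
    by move=> p zp; apply: Eg_le; rewrite xz (block_le ml zp).
  apply: le_trans (ler_normB _ _) _.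
  have -> : 32 * d ^+ 2 * L2_const C0 * mf * mg * d ^+ l =
      L2_const C0 * (4 * d * mf) * (4 * d * mg) * d ^+ l +
      L2_const C0 * (4 * d * mf) * (4 * d * mg) * d ^+ l by ring.
  apply: lerD; first exact: G.
  rewrite block_sum_avg normrM (ger0_norm (ltW (dX_gt0 l))) ler_pM2r //.
  apply: le_trans (ler_norm_avg _ _ _) _; apply: avg_le => // z xz.
  rewrite normrM normfV (ger0_norm (ltW (dX_gt0 _))) ler_pdivrMr //.
  exact: G.
have -> : tree_const * mf * mg * d ^+ l = 8 * C0 * u%:R * mf * mg * d ^+ l +
    (8 * C0 * d * v%:R * mf * mg * d ^+ l +
     32 * d ^+ 2 * L2_const C0 * mf * mg * d ^+ l) by rewrite /tree_const; ring.
apply: le_trans (ler_normD _ _) _.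
by apply: lerD => //; apply: le_trans (ler_normD _ _) _; apply: lerD.
Qed.

Let stop_f k y := 4 * mf < avg k absf y.
Let stop_g k y := 4 * mg < avg k absg y.
Let stop k y := (c l x == c l y) && (stop_f k y || stop_g k y).
Let tau := stopping_time stop l.

Let stop_eq k y z : (k < l)%N -> c k y = c k z -> stop k y = stop k z.
Proof.
move=> kl e; rewrite /stop /stop_f /stop_g !(avg_eq _ e).
by rewrite (block_le (ltnW kl) e).
Qed.

Let tauA : adapted tau. Proof. exact: stopping_time_adapted stop_eq. Qed.
Let taul q : (tau q < l)%N. Proof. exact: stopping_time_lt. Qed.

(** The maximal inequality of weak type (1,1) for the stopped averages: the sum of
    those averages is the sum of the function itself. *)
Lemma weak_type h (m := avg l (fun z => `|h z|) x) :
  \sum_(q | (c l x == c l q) && (4 * m < avg (tau q) (fun z => `|h z|) q)) 1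
    <= d ^+ l / 4.
Proof.
pose B q := (c l x == c l q) && (4 * m < avg (tau q) (fun z => `|h z|) q).
change (\sum_(q | B q) 1 <= d ^+ l / 4 :> R).
have m0 : 0 <= m by exact: avg_abs_ge0.
have le_m : \sum_(q | B q) avg (tau q) (fun z => `|h z|) q <= m * d ^+ l.
  rewrite -block_sum_avg big_mkcond.
  rewrite (eq_bigr (fun q => (B q)%:R * avg (tau q) (fun z => `|h z|) q)); last first.
    by move=> q _; case: ifP => _; rewrite ?mul1r ?mul0r.
  rewrite avg_adapted //.
  - rewrite /block_sum [leRHS]big_mkcond; apply: ler_sum => q _; rewrite /B.
    by have [_|_] /= := eqVneq; [case: ltP; rewrite ?mul1r ?mul0r|rewrite mul0r].
  - by move=> q; exact: leq_trans (ltnW (taul q)) ln.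
  - move=> y z e; rewrite /B (tauA e) (avg_eq _ e).
    by rewrite (block_le (ltnW (taul y)) e).
have [m_eq0|m_neq0] := eqVneq m 0.
  rewrite big_pred0 ?divr_ge0 ?(ltW (dX_gt0 l)) // => q.
  apply/negbTE/negP => Bq; move: le_m; rewrite m_eq0 mul0r leNgt => /negP; apply.
  rewrite (bigD1 q) //= ltr_pwDl //; last by apply: sumr_ge0.
  by case/andP: Bq; rewrite m_eq0 mulr0.
have m_gt0 : 0 < m by rewrite lt_neqAle eq_sym m_neq0.
rewrite ler_pdivlMr // -(ler_pM2l m_gt0); apply: le_trans le_m.
rewrite mulr_suml mulr_sumr; apply: ler_sum => q /andP[_ /ltW].
by rewrite mul1r mulrC.
Qed.

(** Each of the two stopping conditions fills at most a quarter of the block. *)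
Lemma unstopped_half :
  mf * mg * d ^+ l <=
    2 * (mf * mg * \sum_(q | (c l x == c l q) && ~~ stop (tau q) q) 1).
Proof.
have U_le : \sum_(q | (c l x == c l q) && stop (tau q) q) 1 <= d ^+ l / 2 :> R.
  apply: (@le_trans _ _
    (\sum_(q | (c l x == c l q) && (4 * mf < avg (tau q) absf q)) 1 +
     \sum_(q | (c l x == c l q) && (4 * mg < avg (tau q) absg q)) 1)); last first.
    apply: le_trans (lerD (weak_type f) (weak_type g)) _; lra.
  rewrite big_mkcond [X in _ <= X + _]big_mkcond [X in _ <= _ + X]big_mkcond.
  rewrite -big_split /=; apply: ler_sum => q _; rewrite /stop /stop_f /stop_g.
  by case: (c l x == c l q); case: (_ < avg _ absf _); case: (_ < avg _ absg _);
     rewrite /= ?addr0 ?add0r ?lerDl.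
have total : \sum_(q | (c l x == c l q) && stop (tau q) q) 1 +
    \sum_(q | (c l x == c l q) && ~~ stop (tau q) q) 1 = d ^+ l :> R.
  by rewrite -(block_card x ln) /block_sum [RHS](bigID (fun q => stop (tau q) q)).
have : 0 <= mf * mg by rewrite mulr_ge0 // avg_abs_ge0.
nra.
Qed.

(** The induction step: the stopped blocks are charged to Phi on themselves, and
    the cubes above them to Phi on the remaining half of the block. *)
Lemma tree_step (Phi : X -> R) (K : R) : tree_const <= K ->
  (forall q, c l x = c l q -> mf * mg <= Phi q) ->
  (forall k q, (k < l)%N -> `|pairing a k f g q| <= 2 * K * block_sum k Phi q) ->
  `|pairing a l f g x| <= 2 * K * block_sum l Phi x.
Proof.
move=> K_ge Phi_ge IH.
have K_ge0 : 0 <= K.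
  by apply: le_trans K_ge; exact/tree_const_ge0/(le_trans _ (a_le 0 x x)).
have taul' q : (tau q <= l)%N by exact: ltnW.
rewrite (pairing_tree a f g x tauA taul' ln).
apply: le_trans (ler_normD _ _) _.
have tree_le : `|tree_form tau a l f g x| <=
    2 * K * \sum_(q | (c l x == c l q) && ~~ stop (tau q) q) Phi q.
  apply: le_trans (tree_form_bound tauA taul _) _.
    move=> p k xp /andP[pk]; rewrite leq_eqVlt => /orP[/eqP ->|kl].
      rewrite -!(avg_eq _ xp) -/mf -/mg.
      have := avg_abs_ge0 f l x; have := avg_abs_ge0 g l x; rewrite -/mf -/mg.
      by move=> ? ?; split; lra.
    have : ~~ stop k p.
      by apply/negP => /(stopping_time_max kl); rewrite leqNgt pk.
    by rewrite /stop xp eqxx /= negb_or -!leNgt => /andP.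
  have mfg0 : 0 <= mf * mg by rewrite mulr_ge0 // avg_abs_ge0.
  apply: (@le_trans _ _ (K * (mf * mg * d ^+ l))).
    rewrite (_ : _ * d ^+ l = tree_const * (mf * mg * d ^+ l)); last by ring.
    by rewrite ler_wpM2r // mulr_ge0 // ltW.
  rewrite -[leRHS]mulrA [leRHS]mulrCA ler_wpM2l //.
  apply: le_trans unstopped_half _; rewrite ler_pM2l // mulr_sumr.
  by apply: ler_sum => q /andP[/eqP xq _]; rewrite mulr1 Phi_ge.
have stopped_le : `|block_sum l (fun q => pairing a (tau q) f g q / d ^+ tau q) x| <=
    2 * K * \sum_(q | (c l x == c l q) && stop (tau q) q) Phi q.
  apply: le_trans (ler_norm_sum _ _ _) _.
  apply: (@le_trans _ _ (\sum_q (if (c l x == c l q) && stop (tau q) q then 2 * K else 0)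
      * avg (tau q) Phi q)).
    rewrite big_mkcond; apply: ler_sum => q _.
    have [xq|_] /= := eqVneq (c l x) (c l q); last by rewrite mul0r.
    case: ifP => [_|/negbT nstop].
      rewrite normrM normfV (ger0_norm (ltW (dX_gt0 _))) /avg mulrA.
      by rewrite ler_pM2r ?invr_gt0 // IH.
    rewrite mul0r.
    have -> : tau q = 0%N.
      apply/eqP; rewrite -leqn0; apply/bigmax_leqP => k /(stopping_timeP (ltn_ord k)).
      by rewrite -/tau (negbTE nstop).
    by rewrite /pairing /block_sum big1 ?mul0r ?normr0 // => p _;
      rewrite /trunc_shift big_geq ?mul0r.
  rewrite avg_adapted //.
  - rewrite mulr_sumr [leRHS]big_mkcond; apply: ler_sum => q _.
    by case: ifP; rewrite ?mul0r.
  - by move=> q; exact: leq_trans (ltnW (taul q)) ln.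
  - move=> y z e; rewrite (tauA e) (block_le (taul' y) e).
    by rewrite (stop_eq (taul y) e).
rewrite addrC; apply: le_trans (lerD stopped_le tree_le) _.
by rewrite -mulrDr /block_sum [in leRHS](bigID (fun q => stop (tau q) q)).
Qed.

End Local.

(** The smallest admissible Phi is the bilinear maximal function of f and g. *)
Theorem pairing_domination (Phi : X -> R) :
  (forall k q, (k <= n)%N -> avg k absf q * avg k absg q <= Phi q) ->
  forall l x, (l <= n)%N ->
    `|pairing a l f g x| <= 2 * tree_const * block_sum l Phi x.
Proof.
move=> Phi_ge; elim/ltn_ind => l IH x ln.
have K0 : 0 <= tree_const by exact/tree_const_ge0/(le_trans _ (a_le 0 x x)).
have [->|l_gt0] := posnP l.
  rewrite /pairing block_sum0 /trunc_shift big_geq // mul0r normr0 mulr_ge0 //.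
    by rewrite mulr_ge0.
  rewrite block_sum0; apply: le_trans (Phi_ge 0%N x _) => //.
  by rewrite mulr_ge0 // avg_abs_ge0.
apply: tree_step => // [q xq|k q kl].
  by rewrite !(avg_eq _ xq) Phi_ge.
by rewrite IH // (leq_trans (ltnW kl)).
Qed.

End Domination.

(** * The weighted bound for discrete shifts *)

Lemma tree_const_gt0 C0 u v : 0 <= C0 -> 0 < tree_const C0 u v.
Proof.
move=> C0_ge0; rewrite /tree_const ltr_wpDl //.
  by rewrite addr_ge0 // !mulr_ge0 // ltW.
rewrite !mulr_gt0 ?exprn_gt0 // /L2_const.
by have := sqr_ge0 C0; lra.
Qed.

(** The maximal function of a product of two weighted averages is split by the
    pointwise inequality of arithmetic and geometric means, whose two terms are
    controlled by the weighted Doob inequality; the parameter t is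
    chosen at the end so that the dual term is absorbed. *)
Theorem shift_A2_bound (C0 : R) a u v (W sg f : X -> R) (A : R) :
  0 <= C0 ->
  (forall k q p, `|a k q p| <= C0) ->
  (forall f, \sum_q trunc_shift a n f q ^+ 2 <= C0 ^+ 2 * \sum_q f q ^+ 2) ->
  (forall k q p p', c k q = c k p -> c (k - u.+1) p = c (k - u.+1) p' ->
    a k q p = a k q p') ->
  (forall k q q' p, c k p = c k q -> c (k - v.+1) q = c (k - v.+1) q' ->
    a k q p = a k q' p) ->
  (forall x, 0 < W x) -> (forall x, 0 < sg x) -> (forall x, 1 <= W x * sg x) ->
  0 < A -> (forall k x, (k <= n)%N -> avg k W x * avg k sg x <= A) ->
  \sum_q sg q * trunc_shift a n (fun p => W p * f p) q ^+ 2 <=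
    (8 * tree_const C0 u v * A) ^+ 2 * \sum_p W p * f p ^+ 2.
Proof.
move=> C0_ge0 a_le a_L2 a_constr a_constl W0 sg0 Wsg A0 A2.
set K := tree_const C0 u v; have K0 : 0 < K by exact: tree_const_gt0.
set F := fun p => W p * f p; pose psi := trunc_shift a n F.
pose G p := sg p * psi p.
have t0 : 0 < 8 * K * A by rewrite !mulr_gt0.
set t := 8 * K * A in t0 *.
pose Mf := max_mean n W (fun z => `|f z|) n.
pose Mg := max_mean n sg (fun z => `|psi z|) n.
pose Phi q := A / 2 * (t * (W q * Mf q ^+ 2) + t^-1 * (sg q * Mg q ^+ 2)).
have avg_mean k (w h : X -> R) q : (forall x, 0 < w x) ->
    avg k (fun z => `|w z * h z|) q = avg k w q * mean w (fun z => `|h z|) k q.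
  move=> w0; rewrite /avg /mean.
  have -> : block_sum k (fun z => `|w z * h z|) q =
            block_sum k (fun z => w z * `|h z|) q.
    by apply: eq_bigr => z _; rewrite normrM (gtr0_norm (w0 z)).
  by field; rewrite dX_neq0 gt_eqF // block_sum_gt0.
have mean_ge0 k (w h : X -> R) q : (forall x, 0 < w x) ->
    0 <= mean w (fun z => `|h z|) k q.
  move=> w0; rewrite divr_ge0 ?(ltW (block_sum_gt0 w0 _ _)) //.
  by apply: block_sum_ge0 => z _; rewrite mulr_ge0 // ltW.
have Phi_ge k q : (k <= n)%N ->
    avg k (fun z => `|F z|) q * avg k (fun z => `|G z|) q <= Phi q.
  move=> kn; rewrite !avg_mean // mulrACA.
  have xM := mean_le_max_mean W (fun z => `|f z|) q kn; rewrite -/Mf in xM.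
  have yM := mean_le_max_mean sg (fun z => `|psi z|) q kn; rewrite -/Mg in yM.
  have x0 := mean_ge0 k W f q W0; have y0 := mean_ge0 k sg psi q sg0.
  apply: (@le_trans _ _ (A * (Mf q * Mg q))).
    apply: ler_pM => //; last exact: ler_pM.
      by rewrite mulr_ge0 // avg_ge0 // => z _; apply: ltW.
    by rewrite mulr_ge0.
    exact: A2.
  rewrite /Phi -mulrA ler_pM2l // ler_pdivlMl //.
  rewrite -(ler_pM2l (W0 q)) -(ler_pM2l t0).
  have -> : t * (W q * (t * (W q * Mf q ^+ 2) + t^-1 * (sg q * Mg q ^+ 2))) =
     (t * W q * Mf q) ^+ 2 + (W q * sg q) * Mg q ^+ 2.
    by field; rewrite gt_eqF.
  apply: (@le_trans _ _ ((t * W q * Mf q) ^+ 2 + Mg q ^+ 2)).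
    by have := sqr_ge0 (t * W q * Mf q - Mg q); lra.
  by rewrite lerD2l ler_peMl ?sqr_ge0.
set N := \sum_q _; set M := \sum_p _.
have N_le : N <= 2 * K * \sum_q Phi q.
  have -> : N = \sum_q 1 * avg n (fun q => psi q * G q) q.
    rewrite (avg_adapted _ (@adapted_cst n)) //.
    by apply: eq_bigr => q _; rewrite /G /psi /F; ring.
  have -> : \sum_q Phi q = \sum_q 1 * avg n Phi q.
    by rewrite (avg_adapted _ (@adapted_cst n)) //; apply: eq_bigr => q _; rewrite mul1r.
  rewrite mulr_sumr; apply: ler_sum => q _; rewrite !mul1r /avg mulrA.
  rewrite ler_pM2r ?invr_gt0 //; apply: le_trans (ler_norm _) _.
  exact: pairing_domination.
have Phi_le : \sum_q Phi q <= A / 2 * (t * (4 * M) + t^-1 * (4 * N)).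
  rewrite -mulr_sumr big_split /= -!mulr_sumr ler_pM2l ?divr_gt0 //.
  have e (w h : X -> R) : \sum_x w x * h x ^+ 2 = \sum_x w x * `|h x| ^+ 2.
    by apply: eq_bigr => x _; rewrite real_normK ?num_real.
  apply: lerD; rewrite ler_pM2l ?invr_gt0 //.
    by rewrite [M](e W f); exact: doob_maximal.
  by rewrite [N](e sg psi); exact: doob_maximal.
have : N <= 4 * K * A * t * M + N / 2.
  apply: le_trans N_le _.
  have -> : 4 * K * A * t * M + N / 2 =
      2 * K * (A / 2 * (t * (4 * M) + t^-1 * (4 * N))).
    by rewrite /t; field; rewrite !gt_eqF.
  by rewrite ler_pM2l // mulr_gt0.
have -> : t ^+ 2 * M = 2 * (4 * K * A * t * M) by rewrite /t; ring.
lra.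
Qed.

End Shift.
End Blocks.

(** * Lebesgue measure of cubes *)

Section Cubes.
Variables (R : realType).

Lemma measurable_cube_set N (Q : cube R N) : measurable (cube_set Q).
Proof.
rewrite (_ : cube_set Q = \big[setI/setT]_(i <- enum 'I_N)
  ((fun x : 'rV[R]_N => x ord0 i) @^-1`
    `[corner Q ord0 i, corner Q ord0 i + side Q[%classic)).
  apply: bigsetI_measurable => i _; rewrite -[X in measurable X]setTI.
  by apply: measurable_rV_coord => //; exact: measurable_itv.
rewrite -bigcap_seq; apply/seteqP; split=> [x Qx i _ /=|x Qx i].
  by rewrite in_itv /=; exact: Qx.
by have /= := Qx i; rewrite mem_enum in_itv /=; apply.
Qed.

Lemma mu_cube_set N (Q : cube R N) : 0 <= side Q ->
  lebesgue_rV (cube_set Q) = ((side Q) ^+ N)%:E.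
Proof.
elim: N Q => [|N IH] Q l_ge0.
  by rewrite expr0 /= diracE mem_set // => -[].
pose Q' : cube R N := (\row_j corner Q ord0 (rshift 1 j : 'I_(1 + N)), side Q).
rewrite /= /rV_cons_measure /pushforward.
(* A cube is the product of its first side with a cube of one dimension less. *)
rewrite (_ : _ @^-1` _ = `[corner Q ord0 (lshift N ord0 : 'I_(1 + N)),
   corner Q ord0 (lshift N ord0 : 'I_(1 + N)) + side Q[%classic `*` cube_set Q'); last first.
  apply/seteqP; split=> [[a y] /= Qx|[a y] /= [ax Qy] i].
    split=> [|j].
      have := Qx (lshift N ord0 : 'I_(1 + N)); rewrite in_itv /rV_cons /=.
      by rewrite [X in _ <= X](@row_mxEl _ 1 1 N) mxE [X in X < _](@row_mxEl _ 1 1 N) mxE.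
    have := Qx (rshift 1 j : 'I_(1 + N)); rewrite /rV_cons /=.
    by rewrite [X in _ <= X](@row_mxEr _ 1 1 N) [X in X < _](@row_mxEr _ 1 1 N) mxE.
  rewrite /rV_cons; have [j|j] := @split_ordP 1 N i => ->.
    rewrite [X in _ <= X](@row_mxEl _ 1 1 N) mxE [X in X < _](@row_mxEl _ 1 1 N) mxE.
    by rewrite (ord1 j); move: ax; rewrite in_itv.
  rewrite [X in _ <= X](@row_mxEr _ 1 1 N) [X in X < _](@row_mxEr _ 1 1 N).
  by have := Qy j; rewrite /= mxE.
rewrite product_measure1E //; last exact: measurable_cube_set.
rewrite IH // [X in (X * _)%E](_ : _ = (side Q)%:E) ?exprS //.
rewrite [LHS](lebesgue_measure_itv `[_, _[) /= lte_fin ltrDl.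
case: ltP => [_|l_le0]; first by rewrite -EFinB addrAC subrr add0r.
by congr EFin; apply/le_anti/andP.
Qed.

Lemma volume_cube N (Q : cube R N) : 0 <= side Q -> volume Q = side Q ^+ N.
Proof. by move=> l_ge0; rewrite /volume mu_cube_set. Qed.

End Cubes.

(** * Geometry of dyadic systems *)

Section DyadicGeometry.
Variables (R : realType) (N : nat) (beta : int -> 'I_N -> bool).
Local Notation cube := (cube R N).
Local Notation D := (@dyadic_system R N beta).
Implicit Types (I J K : cube) (k : int).

Let offset_set k : [set j : int | ((2 : R) ^ (- j) < 2 ^ (- k))%R] = [set j | k < j].
Proof. by apply/seteqP; split=> j /=; rewrite ltr_eXz2l ?ltrN2 // ltr1n. Qed.

Let term (i : 'I_N) (j : int) : \bar R := ((beta j i)%:R * 2 ^ (- j))%:E.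

Let term_ge0 i j : (0 <= term i j)%E.
Proof. by rewrite lee_fin mulr_ge0 // ltW // exprz_gt0. Qed.

(** The tail of the series is at most the geometric series 2^(-k). *)
Let offset_fin k i : (\esum_(j in [set j : int | (k < j)%R]) term i j)%E \is a fin_num.
Proof.
rewrite ge0_fin_numE; last by apply: esum_ge0 => j _; exact: term_ge0.
have -> : [set j : int | k < j] = (fun n : nat => k + 1 + n%:Z) @` setT.
  apply/seteqP; split=> [j /= kj|_ [n _ <-]] /=; last by lia.
  by exists (absz (j - (k + 1))%R) => //; lia.
rewrite esum_image; last by move=> m n _ _ /= e; lia.
rewrite -nneseries_esumT => [|n]; last exact: term_ge0.
apply: (@le_lt_trans _ _ (2 ^ (- k))%:E); last exact: ltry.
apply: lime_le; first by apply: is_cvg_nneseries => n _ _; exact: term_ge0.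
apply: nearW => n; rewrite sumEFin lee_fin.
apply: (@le_trans _ _ (2 ^ (- k) - 2 ^ (- (k + n%:Z)))); last first.
  by rewrite lerBlDr lerDl ltW // exprz_gt0.
elim: n => [|n IH]; first by rewrite big_geq // addr0 subrr.
rewrite big_nat_recr //=; apply: le_trans (lerD IH (lexx _)) _.
have -> : (2 : R) ^ (- (k + n%:Z)) = 2 * 2 ^ (- (k + n.+1%:Z)).
  by rewrite -{2}[2 : R]expr1z -expfzDr //; congr (_ ^ _); lia.
have -> : k + 1 + n%:Z = k + n.+1%:Z by lia.
have : (0 : R) < 2 ^ (- (k + n.+1%:Z)) by exact: exprz_gt0.
by case: (beta _ i); rewrite ?mul1r ?mul0r; lra.
Qed.

(** Passing to the next smaller scale moves the grid by 0 or by half of a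
    side length, which is why the shifted grids are nested. *)
Lemma dyadic_offset_rec k i :
  dyadic_offset beta (2 ^ (- k) : R) ord0 i =
  (beta (k + 1) i)%:R * 2 ^ (- (k + 1)) +
  dyadic_offset beta (2 ^ (- (k + 1)) : R) ord0 i.
Proof.
rewrite !mxE !offset_set (esumID [set k + 1]); last by move=> j _; exact: term_ge0.
have -> : [set j | (k < j)%R] `&` [set k + 1] = [set k + 1].
  by apply/seteqP; split=> [j [] //|_ -> /=]; split=> //=; lia.
have -> : [set j | (k < j)%R] `&` ~` [set k + 1] = [set j | (k + 1 < j)%R].
  by apply/seteqP; split=> [j [/= kj nj]|j /= kj]; [|split=> /=]; move=> *; lia.
by rewrite esum_set1 ?fineD // ?term_ge0 // offset_fin.
Qed.

Lemma dyadic_systemP I : D I <->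
  exists k (m : 'I_N -> int), side I = 2 ^ (- k) /\
    forall i, corner I ord0 i =
      2 ^ (- k) * (m i)%:~R + dyadic_offset beta (2 ^ (- k)) ord0 i.
Proof.
split=> [[_ [k [m ->]] <-]|[k [m [sI cI]]]].
  by exists k, m; split=> // i; rewrite /corner /side /= !mxE.
exists (\row_i (2 ^ (- k) * (m i)%:~R), 2 ^ (- k)); first by exists k, m.
case: I sI cI => cI sI /= -> cE; congr pair.
by apply/rowP => i; rewrite !mxE cE mxE.
Qed.

Lemma dyadic_side_gt0 I : D I -> 0 < side I.
Proof. by move=> /dyadic_systemP[k [m [-> _]]]; exact: exprz_gt0. Qed.

(** The cubes of one side length form a translate of a lattice partition. *)
Lemma dyadic_eq I J x : D I -> D J -> side I = side J ->
  cube_set I x -> cube_set J x -> I = J.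
Proof.
move=> /dyadic_systemP[k [m [sI cI]]] /dyadic_systemP[l [p [sJ cJ]]] IJ Ix Jx.
have s0 : (0 : R) < 2 ^ (- k) by exact: exprz_gt0.
have e : (2 : R) ^ (- l) = 2 ^ (- k) by rewrite -sI -sJ.
case: I J sI sJ IJ cI cJ Ix Jx => [c1 s1] [c2 s2] /= sI sJ _ cI cJ Ix Jx.
congr pair; last by rewrite sI sJ e.
apply/rowP => i; rewrite [LHS]cI [RHS]cJ e; congr (_ * _%:~R + _).
have := Ix i; have := Jx i; rewrite /corner /side /= in cI cJ *.
rewrite cI cJ e sI sJ e => /andP[a1 a2] /andP[b1 b2].
set o := dyadic_offset _ _ _ _ in a1 a2 b1 b2.
have H (r t : int) : 2 ^ (- k) * r%:~R + o <= x ord0 i ->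
   x ord0 i < 2 ^ (- k) * t%:~R + o + 2 ^ (- k) -> (r <= t)%R.
  move=> h1 h2; have := le_lt_trans h1 h2.
  rewrite addrAC ltrD2r -[X in _ < _ + X]mulr1 -mulrDr ltr_pM2l //.
  by rewrite -(intrD _ t 1) ltr_int; lia.
by apply/le_anti; rewrite (H _ _ b1 a2) (H _ _ a1 b2).
Qed.

Lemma dyadic_child I e : D I -> D (child I e).
Proof.
move=> /dyadic_systemP[k [m [sI cI]]]; apply/dyadic_systemP.
have half : (2 : R) ^ (- k) = 2 * 2 ^ (- (k + 1)).
  by rewrite -{2}[2 : R]expr1z -expfzDr //; congr (_ ^ _); lia.
(* The child with index e sits at lattice index 2 m + beta + e of the finer grid;
   the parent is recovered below by division with remainder. *)
exists (k + 1), (fun i => 2 * m i + (beta (k + 1) i)%:Z + (e i)%:Z).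
rewrite /child /side /= -/(side I) sI half; split; first by field.
move=> i; rewrite /corner /= mxE -/(corner I) cI dyadic_offset_rec half.
by rewrite !intrD intrM !pmulrn; field.
Qed.

Lemma dyadic_parent_ex I : D I -> exists J e, D J /\ I = child J e.
Proof.
move=> /dyadic_systemP[k [m [sI cI]]].
pose r i := m i - (beta k i)%:Z.
pose J : cube := (\row_i (2 ^ (- (k - 1)) * (divz (r i) 2)%:~R +
   dyadic_offset beta (2 ^ (- (k - 1))) ord0 i), 2 ^ (- (k - 1))).
pose e : haar_index N := [ffun i => modz (r i) 2 == 1].
have half : (2 : R) ^ (- (k - 1)) = 2 * 2 ^ (- k).
  by rewrite -{2}[2 : R]expr1z -expfzDr //; congr (_ ^ _); lia.
exists J, e; split.
  apply/dyadic_systemP; exists (k - 1), (fun i => divz (r i) 2); split => // i.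
  by rewrite /corner /= mxE.
case: I sI cI => c1 s1 /= sI cI; rewrite /child /corner /side /=; congr pair; last first.
  by rewrite sI half; field.
apply/rowP => i; rewrite [LHS]cI [RHS]mxE [X in _ = X + _]mxE.
rewrite (dyadic_offset_rec (k - 1)) subrK half ffunE.
have -> : m i = divz (r i) 2 * 2 + (modz (r i) 2 == 1)%:Z + (beta k i)%:Z.
  have := divz_eq (r i) 2; have := modz_ge0 (r i) (isT : (2 : int) != 0).
  have := @ltz_pmod (r i) 2 isT; rewrite /r.
  by case: eqP => [->|] /=; lia.
by rewrite !intrD intrM !pmulrn; field.
Qed.

End DyadicGeometry.

Section DyadicTree.
Variables (R : realType) (N : nat) (beta : int -> 'I_N -> bool).
Local Notation cube := (cube R N).
Local Notation D := (@dyadic_system R N beta).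
Implicit Types (I J K : cube) (k : nat).

Lemma child_sub I e : 0 < side I -> cube_set (child I e) `<=` cube_set I.
Proof.
move=> s0 x Ix i; have := Ix i; rewrite /child /corner /side /= mxE.
rewrite /corner /side in s0 *.
by case: (e i); rewrite ?mul1r ?mul0r; lra.
Qed.

Lemma child_cover I x : cube_set I x -> exists e, cube_set (child I e) x.
Proof.
move=> Ix; exists [ffun i => corner I ord0 i + side I / 2 <= x ord0 i] => i.
have := Ix i; rewrite /child /corner /side /= mxE ffunE.
by case: (leP (I.1 ord0 i + I.2 / 2)); rewrite ?mul1r ?mul0r; lra.
Qed.

Lemma corner_in I : 0 < side I -> cube_set I (corner I).
Proof. by move=> s0 i; rewrite lexx ltrDl. Qed.

(** Outside the dyadic system the value is arbitrary. *)
Definition parent I : cube :=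
  if pselect (D I) is left DI then sval (cid (dyadic_parent_ex DI)) else I.

Lemma parentP I : D I -> D (parent I) /\ exists e, I = child (parent I) e.
Proof.
rewrite /parent; case: pselect => // DI _.
by case: cid => J /= [e [DJ IJ]]; split=> //; exists e.
Qed.

Lemma parent_dyadic I : D I -> D (parent I).
Proof. by move=> /parentP[]. Qed.

Lemma side_parent I : D I -> side (parent I) = 2 * side I.
Proof. by move=> /parentP[_ [e {2}->]]; rewrite /side /=; field. Qed.

Lemma parent_sub I : D I -> cube_set I `<=` cube_set (parent I).
Proof.
move=> /parentP[Dp [e {1}->]]; apply: child_sub; exact: dyadic_side_gt0 Dp.
Qed.

Lemma parent_child J e : D J -> parent (child J e) = J.
Proof.
move=> DJ; have DI := dyadic_child e DJ; have s0 := dyadic_side_gt0 DI.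
apply: (@dyadic_eq _ _ beta _ _ (corner (child J e))) => //.
- exact: parent_dyadic.
- by rewrite side_parent // /side /=; field.
- by apply: parent_sub => //; exact: corner_in.
- by apply: (child_sub (dyadic_side_gt0 DJ)); exact: corner_in.
Qed.

Definition ancestor k I := iter k parent I.

Lemma ancestor_dyadic k I : D I -> D (ancestor k I).
Proof. by move=> DI; elim: k => //= k; exact: parent_dyadic. Qed.

Lemma side_ancestor k I : D I -> side (ancestor k I) = 2 ^+ k * side I.
Proof.
move=> DI; elim: k => [|k IH]; first by rewrite mul1r.
by rewrite /= side_parent ?IH ?mulrA ?exprS //; exact: ancestor_dyadic.
Qed.

Lemma ancestor_sub k I : D I -> cube_set I `<=` cube_set (ancestor k I).
Proof.
move=> DI; elim: k => [|k IH] //=; apply: subset_trans IH _.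
by apply: parent_sub; exact: ancestor_dyadic.
Qed.

Lemma ancestor_cover k K x : D K -> cube_set K x ->
  exists I, [/\ D I, ancestor k I = K & cube_set I x].
Proof.
elim: k K => [|k IH] K DK Kx; first by exists K.
have [e Jx] := child_cover Kx.
have [I [DI IJ Ix]] := IH _ (dyadic_child e DK) Jx.
by exists I; split => //; rewrite /ancestor iterS -/(ancestor k I) IJ parent_child.
Qed.

Lemma ancestor_unique k I K x : D I -> D K -> side K = 2 ^+ k * side I ->
  cube_set I x -> cube_set K x -> ancestor k I = K.
Proof.
move=> DI DK sK Ix Kx; apply: (@dyadic_eq _ _ beta _ _ x) => //.
- exact: ancestor_dyadic.
- by rewrite sK side_ancestor.
- exact: ancestor_sub Ix.
Qed.

Lemma descendants_ex (tops : seq cube) n : (forall T, T \in tops -> D T) ->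
  exists s : seq cube, forall I, I \in s <-> D I /\ ancestor n I \in tops.
Proof.
move=> Dtops; elim: n => [|n [s sP]].
  by exists tops => I; split=> [/[dup] /Dtops|[]].
exists [seq child J e | J <- s, e <- enum (haar_index N)] => I; split.
  move=> /allpairsP[[J e] /= [/sP[DJ Jtop] _ ->]].
  split; first exact: dyadic_child.
  by rewrite /ancestor -iterS iterSr parent_child.
move=> [DI]; rewrite /ancestor iterSr => Itop.
have [DJ [e IJ]] := parentP DI.
apply/allpairsP; exists (parent I, e) => /=; split=> //.
  by apply/sP.
by rewrite mem_enum.
Qed.

End DyadicTree.

Section SimpleIntegral.
Context d (T : measurableType d) (R : realType) (mu : {measure set T -> \bar R}).
Local Open Scope ereal_scope.

(** Integration of a step function against f, the only form in which integrals
    over several atoms are computed. *)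
Lemma integral_simple (I : finType) (F : I -> set T) (phi f : T -> R) (a : I -> R) :
  (forall i, measurable (F i)) ->
  (forall i j x, F i x -> F j x -> i = j) ->
  (forall i x, F i x -> phi x = a i) ->
  (forall x, (forall i, ~ F i x) -> phi x = 0%R) ->
  (forall i, mu.-integrable (F i) (EFin \o f)) ->
  \int[mu]_x (phi x * f x)%:E = (\sum_i a i * \int[mu]_(x in F i) f x)%:E.
Proof.
move=> mF Fdisj phiF phi0 fint.
have fF i : mu.-integrable setT ((EFin \o f) \_ (F i)).
  by rewrite -integrable_mkcond.
transitivity (\int[mu]_x (\sum_i (a i)%:E * ((EFin \o f) \_ (F i)) x)).
  apply: eq_integral => x _; have [[i Fix]|nF] := pselect (exists i, F i x).
    rewrite (bigD1 i) //= big1 ?adde0 => [|j ji].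
      by rewrite patchE mem_set //= (phiF i x Fix) EFinM.
    rewrite patchE memNset ?mule0 // => Fjx; move/eqP: ji; apply.
    exact: Fdisj Fjx Fix.
  rewrite phi0 ?mul0r ?big1 // => i; last by move=> Fix; apply: nF; exists i.
  by rewrite patchE memNset ?mule0 // => Fix; apply: nF; exists i.
rewrite integral_sum // => [|i]; last exact: integrableZl.
rewrite -sumEFin; apply: eq_bigr => i _.
rewrite integralZl // -integral_mkcond EFinM fineK //.
exact: integrable_fin_num.
Qed.

End SimpleIntegral.

(** * Kernels of dyadic shifts, and the choice of atoms *)

Section Kernel.
Variables (R : realType) (N : nat) (beta : int -> 'I_N -> bool).
Local Notation cube := (cube R N).
Local Notation D := (@dyadic_system R N beta).
Variables (cN : R) (h : cube -> haar_index N -> 'rV[R]_N -> R) (u v : nat).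
Variable a : cube -> cube -> cube -> haar_index N -> haar_index N -> R.
Hypothesis haar : forall I, D I -> haar_functions cN I (h I).
Local Notation kernel := (shift_kernel D h u v a).

(** A dyadic cube of half the side length that meets I is one of its children. *)
Lemma haar_const I C eta y z : D I -> D C -> side I = 2 * side C ->
  cube_set C y -> cube_set C z -> h I eta y = h I eta z.
Proof.
move=> DI DC sIC Cy Cz; have [h0 hchild _ _ _] := haar DI.
have H t : cube_set C t -> cube_set I t -> exists e, child I e = C.
  move=> Ct /child_cover[e et]; exists e.
  apply: (@dyadic_eq _ _ beta _ _ t) => //; first exact: dyadic_child.
  by rewrite /side /= -/(side I) sIC; field.
have sub e : child I e = C -> cube_set C `<=` cube_set I.
  by move=> <-; apply: child_sub; exact: dyadic_side_gt0 DI.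
have [Iy|nIy] := pselect (cube_set I y).
  by have [e eC] := H _ Cy Iy; apply: (hchild eta e); rewrite eC.
have [Iz|nIz] := pselect (cube_set I z); last by rewrite !h0.
by have [e eC] := H _ Cz Iz; case: nIy; exact: (sub e).
Qed.

(** In its second variable the kernel is a combination of Haar functions of cubes
    of side 2^(-u) l(K), hence constant on the children of those cubes. *)
Lemma kernel_const_y K C x y z : D C -> side K = 2 ^+ u.+1 * side C ->
  cube_set C y -> cube_set C z -> kernel K x y = kernel K x z.
Proof.
move=> DC sK Cy Cz; apply: eq_fsbigr => I /set_mem[DI _ sI].
apply: eq_fsbigr => J _; apply: eq_bigr => eta _; apply: eq_bigr => theta _.
congr (_ * _); apply: haar_const Cy Cz => //.
by rewrite sI sK exprS; field; rewrite expf_neq0.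
Qed.

Lemma kernel_const_x K C x z y : D C -> side K = 2 ^+ v.+1 * side C ->
  cube_set C x -> cube_set C z -> kernel K x y = kernel K z y.
Proof.
move=> DC sK Cx Cz; apply: eq_fsbigr => I _.
apply: eq_fsbigr => J /set_mem[DJ _ sJ].
apply: eq_bigr => eta _; apply: eq_bigr => theta _.
congr (_ * _ * _); apply: haar_const Cx Cz => //.
by rewrite sJ sK exprS; field; rewrite expf_neq0.
Qed.

Lemma kernel_out_y K x y : ~ cube_set K y -> kernel K x y = 0.
Proof.
move=> nKy; apply: fsbig1 => I [DI IK _]; apply: fsbig1 => J _.
apply: big1 => eta _; apply: big1 => theta _.
by have [h0 _ _ _ _] := haar DI; rewrite h0 ?mulr0 // => /IK.
Qed.

Lemma kernel_out_x K x y : ~ cube_set K x -> kernel K x y = 0.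
Proof.
move=> nKx; apply: fsbig1 => I _; apply: fsbig1 => J [DJ JK _].
apply: big1 => eta _; apply: big1 => theta _.
by have [h0 _ _ _ _] := haar DJ; rewrite h0 ?mulr0 ?mul0r // => /JK.
Qed.

Lemma component_out_x K f x : ~ cube_set K x -> shift_component D h u v a K f x = 0.
Proof.
move=> nKx; rewrite /shift_component (@eq_Rintegral _ _ _ _ _ (fun=> 0)); last first.
  by move=> y _; rewrite kernel_out_x ?mul0r.
by rewrite Rintegral_cst ?mul0r ?mulr0 //; exact: measurable_cube_set.
Qed.

End Kernel.

Section Levels.
Variables (R : realType) (N : nat) (beta : int -> 'I_N -> bool).
Local Notation cube := (cube R N).
Local Notation D := (@dyadic_system R N beta).

Lemma levels_bounded (Ks : seq cube) : (forall K, K \in Ks -> D K) ->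
  exists lo hi : int, lo <= hi /\ forall K, K \in Ks ->
    exists2 k : int, lo <= k <= hi & side K = 2 ^ (- k).
Proof.
elim: Ks => [_|K Ks IH DK]; first by exists 0, 0.
have [|lo [hi [lohi H]]] := IH; first by move=> L LK; apply: DK; rewrite inE LK orbT.
have /dyadic_systemP[k [m [sK _]]] := DK K (mem_head _ _).
exists (Num.min k lo), (Num.max k hi); split.
  by rewrite ge_min le_max lexx.
move=> L; rewrite inE => /predU1P[->|/H[l /andP[lol lhi] sL]].
  by exists k => //; rewrite ge_min le_max !lexx.
by exists l => //; rewrite ge_min le_max lol lhi !orbT.
Qed.

(** A finite set of dyadic cubes has ancestors of a common side length; the
    descendants of those ancestors at a fine enough level are the atoms.  The set
    of atoms is closed under passing to another atom with the same ancestor, so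
    that all blocks up to level n are full dyadic cubes. *)
Lemma atoms_ex (Ks : seq cube) (M : nat) : (forall K, K \in Ks -> D K) ->
  exists (s : seq cube) (s0 : R) (n : nat),
  [/\ 0 < s0,
      forall I, I \in s -> D I /\ side I = s0,
      forall I J k, I \in s -> (k <= n)%N -> D J ->
        ancestor beta k J = ancestor beta k I -> J \in s
    & forall K x, K \in Ks -> cube_set K x -> exists I k,
        [/\ I \in s, (M < k <= n)%N, ancestor beta k I = K & cube_set I x]].
Proof.
move=> DKs; have [lo [hi [lohi levels]]] := levels_bounded DKs.
pose n := (absz (hi - lo)%R + M.+1)%N.
pose tops := [seq ancestor beta j K | K <- Ks,
  j <- [seq j <- iota 0 n.+1 | side (ancestor beta j K) == 2 ^ (- lo)]].
have Dtops T : T \in tops -> D T /\ side T = 2 ^ (- lo).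
  move=> /allpairsPdep[K [j [KKs]]]; rewrite mem_filter => /andP[/eqP sT _] ->.
  by split=> //; apply: ancestor_dyadic; exact: DKs.
have [|s sP] := @descendants_ex R N beta tops n; first by move=> T /Dtops[].
exists s, (2 ^ (- (lo + n%:Z))), n; split.
- exact: exprz_gt0.
- move=> I /sP[DI /Dtops[_]]; rewrite side_ancestor // => sI; split=> //.
  apply: (@mulfI _ (2 ^+ n)); first by rewrite expf_neq0.
  by rewrite sI exprnP -expfzDr //; congr (_ ^ _); lia.
- move=> I J k /sP[_ Itop] kn DJ JI; apply/sP; split=> //.
  by move: Itop; rewrite -(subnK kn) /ancestor !iterD -/(ancestor beta k I) -JI.
- move=> K x KKs Kx; have [k /andP[lok khi] sK] := levels K KKs.
  pose i := absz (hi + M.+1%:Z - k)%R.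
  have [I [DI IK Ix]] := ancestor_cover i (DKs _ KKs) Kx.
  exists I, i; split=> //; last by rewrite /i /n; lia.
  apply/sP; split=> //; apply/allpairsPdep; exists K, (absz (k - lo)%R).
  have e : n = (absz (k - lo)%R + i)%N by rewrite /n /i; lia.
  rewrite mem_filter mem_iota side_ancestor ?sK; last exact: DKs.
  split=> //; last by rewrite e /ancestor iterD -/(ancestor beta i I) IK.
  apply/andP; split; last by rewrite e; lia.
  by rewrite exprnP -expfzDr //; apply/eqP; congr (_ ^ _); lia.
Qed.

End Levels.

(** * Weights *)

Section AlmostEverywhere.
Context d (T : measurableType d) (R : realType) (mu : {measure set T -> \bar R}).

Lemma measurable_inv (w : T -> R) : measurable_fun setT w ->
  measurable_fun setT (fun x => (w x)^-1).
Proof.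
move=> w_meas.
(* Written so that the power function is only applied to nonnegative numbers,
   and so that the value at 0 is the conventional one. *)
have -> : (fun x => (w x)^-1) = (fun x => w x * (w x ^+ 2) `^ (-1)).
  apply/funext => x; rewrite powR_inv1 ?sqr_ge0 //.
  have [->|w0] := eqVneq (w x) 0; first by rewrite invr0 mul0r.
  by field.
apply: measurable_funM => //.
apply: (@measurableT_comp _ _ _ _ _ _ (fun t : R => t `^ (-1))).
  exact: measurable_powR.
exact: measurable_funX.
Qed.

Lemma ae_eq_integrable (D : set T) (f g : T -> R) : measurable D ->
  measurable_fun setT f -> measurable_fun setT g -> {ae mu, forall x, f x = g x} ->
  mu.-integrable D (EFin \o g) ->
  mu.-integrable D (EFin \o f) /\
  (\int[mu]_(x in D) (f x)%:E = \int[mu]_(x in D) (g x)%:E)%E.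
Proof.
move=> Dm fm gm fg /integrableP[_ g_fin].
have fm' : measurable_fun D (EFin \o f).
  by apply/measurable_EFinP; exact: measurable_funTS.
have gm' : measurable_fun D (EFin \o g).
  by apply/measurable_EFinP; exact: measurable_funTS.
split; last first.
  apply: ae_eq_integral => //; apply: filterS fg => x /= -> //.
apply/integrableP; split => //; apply: le_lt_trans g_fin.
rewrite le_eqVlt; apply/orP; left; apply/eqP.
apply: ae_eq_integral => //.
- exact: measurableT_comp.
- exact: measurableT_comp.
- by apply: filterS fg => x /= -> //.
Qed.

End AlmostEverywhere.

(** A cube lies in a compact box. *)
Lemma locally_integrable_cube (R : realType) (N : nat) (w : 'rV[R]_N -> R)
    (Q : cube R N) :
  locally_integrable_rV w -> lebesgue_rV.-integrable (cube_set Q) (EFin \o w).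
Proof.
move=> [w_meas w_fin].
have Qm := measurable_cube_set Q.
pose box := [set x : 'rV[R]_N | forall i,
  `[corner Q ord0 i, corner Q ord0 i + side Q]%classic (x ord0 i)].
have box_compact : compact box.
  apply: (@rV_compact R N
    (fun i => `[corner Q ord0 i, corner Q ord0 i + side Q]%classic)) => i.
  exact: segment_compact.
apply/integrableP; split; first by apply/measurable_EFinP; exact: measurable_funTS.
apply: le_lt_trans (w_fin box box_compact).
apply: ge0_subset_integral => //=.
- rewrite (_ : box = \big[setI/setT]_(i <- enum 'I_N)
    ((fun x : 'rV[R]_N => x ord0 i) @^-1`
    `[corner Q ord0 i, corner Q ord0 i + side Q]%classic)).
    apply: bigsetI_measurable => i _; rewrite -[X in measurable X]setTI.
    by apply: measurable_rV_coord => //; exact: measurable_itv.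
  rewrite -bigcap_seq; apply/seteqP; split=> [x Qx i _|x Qx i]; first exact: Qx.
  by apply: Qx; rewrite /= mem_enum.
- apply/measurable_EFinP; apply: measurableT_comp => //; exact: measurable_funTS.
- by move=> x Qx i; rewrite /= in_itv /=; case/andP: (Qx i) => -> /ltW.
Qed.

Section PositiveWeights.
Variables (R : realType) (N : nat) (w : 'rV[R]_N -> R).
Local Notation mu := (@lebesgue_rV R N).
Hypotheses (w_meas : measurable_fun setT w) (w_gt0 : forall x, 0 < w x).
Hypothesis weight_integrable : forall Q : cube R N,
  mu.-integrable (cube_set Q) (EFin \o w).
Implicit Type Q : cube R N.

Lemma weight_int_gt0 Q : 0 < side Q -> (0 < \int[mu]_(x in cube_set Q) (w x)%:E)%E.
Proof.
move=> s0; have Qm := measurable_cube_set Q.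
have Q0 : (0 <= \int[mu]_(x in cube_set Q) (w x)%:E)%E.
  by apply: integral_ge0 => x _; rewrite lee_fin ltW.
rewrite lt_neqAle Q0 andbT; apply/eqP => /esym int0.
have w_meas' : measurable_fun (cube_set Q) (EFin \o w).
  by apply/measurable_EFinP; exact: measurable_funTS.
have : (\int[mu]_(x in cube_set Q) `|(EFin \o w) x| = 0)%E.
  rewrite -int0; apply: eq_integral => x _ /=.
  by rewrite ger0_norm // ltW.
move=> /(ae_eq_integral_abs mu Qm w_meas')[Z [Zm Z0 subZ]].
have : (mu (cube_set Q) <= mu Z)%E.
  apply: le_measure; rewrite ?inE //.
  move=> x Qx; apply: subZ => /= /(_ Qx) []; apply/eqP.
  by rewrite gt_eqF.
by rewrite Z0 [X in (X <= _)%E](mu_cube_set (ltW s0)) lee_fin leNgt exprn_gt0.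
Qed.

Section A2.
Hypothesis A2_fin : (A2_norm w < +oo)%E.

(** If the integral of 1/w over Q were infinite, so would be the A_2 constant,
    because the integral of w over Q is positive. *)
Lemma inv_weight_integrable Q : 0 < side Q ->
  mu.-integrable (cube_set Q) (EFin \o (fun x => (w x)^-1)).
Proof.
move=> s0; apply/integrableP; split.
  by apply/measurable_EFinP; apply: measurable_funTS; exact: measurable_inv.
rewrite (eq_integral (fun x => (w x)^-1%:E)) => [|x _]; last first.
  by rewrite /= ger0_norm // invr_ge0 ltW.
rewrite ltey; apply/eqP => int_oo.
have V0 : 0 < (volume Q)^-1 by rewrite invr_gt0 volume_cube ?exprn_gt0 // ltW.
suff : (+oo <= A2_norm w)%E by rewrite leNgt A2_fin.
apply: ereal_sup_ubound; exists Q => //.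
by rewrite int_oo !gt0_muley ?mule_gt0 ?lte_fin // weight_int_gt0.
Qed.

Lemma weight_fin Q : (\int[mu]_(x in cube_set Q) (w x)%:E)%E \is a fin_num.
Proof.
exact: (@integrable_fin_num _ _ _ mu _ (measurable_cube_set Q) (EFin \o w)
  (weight_integrable Q)).
Qed.

Lemma inv_weight_fin Q : 0 < side Q ->
  (\int[mu]_(x in cube_set Q) ((w x)^-1)%:E)%E \is a fin_num.
Proof.
move=> s0; exact: (@integrable_fin_num _ _ _ mu _ (measurable_cube_set Q) (EFin \o _)
  (inv_weight_integrable s0)).
Qed.

Lemma A2_average Q : 0 < side Q ->
  (((volume Q)^-1 * (\int[mu]_(x in cube_set Q) w x) *
  ((volume Q)^-1 * \int[mu]_(x in cube_set Q) (w x)^-1))%:E <= A2_norm w)%E.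
Proof.
move=> s0; apply: ereal_sup_ubound; exists Q => //.
by rewrite EFinM !EFinM /Rintegral !fineK // ?weight_fin ?inv_weight_fin.
Qed.

Lemma weight_Rint_gt0 Q : 0 < side Q -> 0 < \int[mu]_(x in cube_set Q) w x.
Proof.
by move=> s0; rewrite -lte_fin /Rintegral fineK ?weight_fin // weight_int_gt0.
Qed.

(** Integrate t w + 1 / (t w) >= 2 over Q and choose t = |Q| / w(Q). *)
Lemma weight_AM_GM Q : 0 < side Q ->
  volume Q ^+ 2 <=
  (\int[mu]_(x in cube_set Q) w x) * (\int[mu]_(x in cube_set Q) (w x)^-1).
Proof.
move=> s0; have I0 := weight_Rint_gt0 s0.
have V0 : 0 < volume Q by rewrite volume_cube ?exprn_gt0 // ltW.
set I := \int[mu]_(x in _) w x in I0 *; set J := \int[mu]_(x in _) _.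
have Qm := measurable_cube_set Q.
pose t := volume Q / I; have t0 : 0 < t by rewrite divr_gt0.
have wi := weight_integrable Q; have vi := inv_weight_integrable s0.
have twi : mu.-integrable (cube_set Q) (EFin \o (fun x => t * w x)).
  exact: (integrableZl Qm t wi).
have tvi : mu.-integrable (cube_set Q) (EFin \o (fun x => t^-1 * (w x)^-1)).
  exact: (integrableZl Qm t^-1 vi).
have : \int[mu]_(x in cube_set Q) 2 <=
       \int[mu]_(x in cube_set Q) (t * w x + t^-1 * (w x)^-1).
  apply: le_Rintegral => //.
  - apply: (eq_integrable Qm (cst 2%:E)) => //.
    apply/integrableP; split.
      by apply/measurable_EFinP; exact: measurable_cst.
    rewrite (eq_integral (cst `|2 : R|%:E)) //.
    rewrite integral_cst // [X in (_ * X < _)%E](mu_cube_set (ltW s0)).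
    by rewrite -EFinM ltry.
  - exact: (integrableD Qm twi tvi).
  - move=> x _; rewrite -invfM; set z := t * w x.
    have z0 : 0 < z by rewrite mulr_gt0.
    rewrite -(ler_pM2l z0) [leRHS]mulrDr mulfV ?gt_eqF //.
    by have := sqr_ge0 (z - 1); lra.
rewrite Rintegral_cst // RintegralD // !RintegralZl // -/I -/J -/(volume Q).
rewrite /t invf_div divfK ?gt_eqF // -(ler_pM2l V0).
have -> : volume Q * (volume Q + I / volume Q * J) = volume Q ^+ 2 + I * J.
  by field; rewrite gt_eqF.
lra.
Qed.

Lemma A2_norm_ge1 : (1 <= A2_norm w)%E.
Proof.
pose Q : cube R N := (0, 1); have s0 : 0 < side Q by exact: ltr01.
apply: le_trans (A2_average s0); rewrite lee_fin.
have vQ : volume Q = 1 by rewrite volume_cube ?ltW // /side /= expr1n.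
by have := weight_AM_GM s0; rewrite vQ expr1n invr1 !mul1r.
Qed.

End A2.

End PositiveWeights.

(** * Reduction to atoms *)

Section Discretization.
Variables (R : realType) (N : nat) (beta : int -> 'I_N -> bool).
Local Notation cube := (cube R N).
Local Notation D := (@dyadic_system R N beta).
Local Notation mu := (@lebesgue_rV R N).

Variables (s : seq cube) (s0 : R) (n : nat).
Hypothesis s0_gt0 : 0 < s0.
Hypothesis s_dyadic : forall I, I \in s -> D I /\ side I = s0.
Hypothesis s_closed : forall I J k, I \in s -> (k <= n)%N -> D J ->
  ancestor beta k J = ancestor beta k I -> J \in s.

Definition atom := seq_sub s.
Implicit Types p q : atom.

Definition acube q : cube := ssval q.
Definition block k q : cube := ancestor beta k (acube q).
Local Notation d := ((2 : R) ^+ N).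
Local Notation m := (s0 ^+ N).

Let m_gt0 : 0 < m. Proof. exact: exprn_gt0. Qed.

Lemma acube_dyadic q : D (acube q).
Proof. by case: (s_dyadic (ssvalP q)). Qed.

Lemma acube_side q : side (acube q) = s0.
Proof. by case: (s_dyadic (ssvalP q)). Qed.

Lemma block_dyadic k q : D (block k q).
Proof. exact/ancestor_dyadic/acube_dyadic. Qed.

Lemma block_side k q : side (block k q) = 2 ^+ k * s0.
Proof. by rewrite side_ancestor ?acube_side //; exact: acube_dyadic. Qed.

Lemma acube_sub k q : cube_set (acube q) `<=` cube_set (block k q).
Proof. exact/ancestor_sub/acube_dyadic. Qed.

Lemma block_inj : injective (block 0).
Proof. by move=> p q; exact: val_inj. Qed.

Lemma block_nested k p q : block k p = block k q -> block k.+1 p = block k.+1 q.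
Proof. by rewrite /block /= => ->. Qed.

Lemma acube_disj p q x : cube_set (acube p) x -> cube_set (acube q) x -> p = q.
Proof.
move=> px qx; apply: val_inj; apply: (@dyadic_eq _ _ beta _ _ x) => //.
- exact: acube_dyadic.
- exact: acube_dyadic.
- by rewrite !acube_side.
Qed.

Lemma block_unique k q K x : D K -> side K = 2 ^+ k * s0 ->
  cube_set (acube q) x -> cube_set K x -> block k q = K.
Proof.
move=> DK sK qx Kx; apply: ancestor_unique qx Kx => //; first exact: acube_dyadic.
by rewrite sK acube_side.
Qed.

Lemma atom_cover k q x : (k <= n)%N -> cube_set (block k q) x ->
  exists p, cube_set (acube p) x.
Proof.
move=> kn qx; have [I [DI IK Ix]] := ancestor_cover k (block_dyadic k q) qx.
have Is : I \in s by apply: (s_closed (ssvalP q) kn DI).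
by exists (SeqSub Is).
Qed.

Lemma block_mem k q p x : cube_set (acube p) x ->
  cube_set (block k q) x <-> block k q = block k p.
Proof.
move=> px; split=> [qx|->]; last exact: acube_sub px.
apply/esym; apply: block_unique px qx; first exact: block_dyadic.
exact: block_side.
Qed.

Definition atom_integrable (f : 'rV[R]_N -> R) :=
  forall q, mu.-integrable (cube_set (acube q)) (EFin \o f).

Definition atom_int (f : 'rV[R]_N -> R) q : R :=
  \int[mu]_(x in cube_set (acube q)) f x.

Lemma integral_atoms (phi f : 'rV[R]_N -> R) (b : atom -> R) :
  (forall q x, cube_set (acube q) x -> phi x = b q) ->
  (forall x, (forall q, ~ cube_set (acube q) x) -> phi x = 0) ->
  atom_integrable f ->
  (\int[mu]_x (phi x * f x)%:E)%E = (\sum_q b q * atom_int f q)%:E.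
Proof.
move=> phib phi0 fint.
apply: (@integral_simple _ _ _ mu _ (fun q => cube_set (acube q))) => //.
- by move=> q; exact: measurable_cube_set.
- by move=> p q x; exact: acube_disj.
Qed.

Lemma integral_block f k q : (k <= n)%N -> atom_integrable f ->
  (\int[mu]_(x in cube_set (block k q)) (f x)%:E)%E =
  (block_sum block k (atom_int f) q)%:E.
Proof.
move=> kn fint; rewrite integral_mkcond.
transitivity (\int[mu]_x (\1_(cube_set (block k q)) x * f x)%:E)%E.
  apply: eq_integral => x _; rewrite patchE indicE.
  by case: ifP => _; rewrite ?mul1r ?mul0r.
rewrite (@integral_atoms _ _ (fun p => (block k q == block k p)%:R)) //.
- congr EFin; rewrite /block_sum [RHS]big_mkcond; apply: eq_bigr => p _.
  by case: eqP; rewrite ?mul1r ?mul0r.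
- move=> p x px; rewrite indicE; congr (_%:R); congr nat_of_bool.
  apply/idP/eqP => [/set_mem|]; first by move/(block_mem k q px).
  by move/(block_mem k q px)/mem_set.
- move=> x nx; rewrite indicE memNset // => /(atom_cover kn)[p px].
  exact: nx px.
Qed.

Lemma mu_acube q : mu (cube_set (acube q)) = m%:E.
Proof. by rewrite mu_cube_set acube_side // ltW. Qed.

Lemma integrable_cst q (r : R) : mu.-integrable (cube_set (acube q)) (EFin \o cst r).
Proof.
apply/integrableP; split; first by apply/measurable_EFinP; exact: measurable_cst.
rewrite (eq_integral (cst `|r|%:E)) //.
rewrite integral_cst; last exact: measurable_cube_set.
by rewrite [X in (_ * X < _)%E](mu_acube q) -EFinM ltry.
Qed.

Lemma block_volume k q : volume (block k q) = d ^+ k * m.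
Proof.
rewrite volume_cube block_side; last by rewrite mulr_ge0 // ?exprn_ge0 // ltW.
by rewrite exprMn -!exprM mulnC.
Qed.

(** Atoms are counted by comparing volumes. *)
Lemma block_card k q : (k <= n)%N -> block_sum block k (fun=> 1) q = d ^+ k.
Proof.
move=> kn; have one_int : atom_integrable (cst 1) by move=> p; exact: integrable_cst.
have := integral_block q kn one_int.
rewrite [LHS](integral_cst mu (measurable_cube_set (block k q)) 1%:E).
rewrite mul1e [LHS]mu_cube_set block_side; last first.
  by rewrite mulr_ge0 // ?exprn_ge0 // ltW.
move=> -[] /esym.
have -> : block_sum block k (atom_int (cst 1)) q = block_sum block k (fun=> 1) q * m.
  rewrite /block_sum mulr_suml; apply: eq_bigr => p _.
  rewrite /atom_int Rintegral_cst; last exact: measurable_cube_set.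
  by rewrite [X in _ * fine X](mu_acube p) mul1r.
rewrite exprMn -!exprM [(k * N)%N]mulnC exprM => /mulIf; apply.
by rewrite gt_eqF.
Qed.

Section ShiftOnAtoms.
Variables (cN : R) (h : cube -> haar_index N -> 'rV[R]_N -> R) (u v : nat).
Variable a : cube -> cube -> cube -> haar_index N -> haar_index N -> R.
Hypothesis haar : forall I, D I -> haar_functions cN I (h I).
Local Notation kernel := (shift_kernel D h u v a).
Local Notation component := (shift_component D h u v a).

Variable Ks : seq cube.
Hypothesis Ks_supp : forall K, D K -> K \notin Ks -> component K = fun _ _ => 0.
Hypothesis Ks_atoms : forall K x, K \in Ks -> cube_set K x -> exists I k,
  [/\ I \in s, (maxn u v < k <= n)%N, ancestor beta k I = K & cube_set I x].

(** The kernel of the cube is sampled at corners, being constant on atoms.  It is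
    set to zero for the cubes outside Ks, where the component vanishes although
    its kernel need not be constant on atoms. *)
Definition akernel k q p : R :=
  if block k q \in Ks then kernel (block k q) (corner (acube q)) (corner (acube p))
  else 0.

Let corner_acube q : cube_set (acube q) (corner (acube q)).
Proof. by apply: corner_in; rewrite acube_side. Qed.

Lemma Ks_level k q : block k q \in Ks -> (maxn u v < k <= n)%N.
Proof.
move=> Kk; have Kc := acube_sub k (corner_acube q).
have [I [k' [Is k'n IK _]]] := Ks_atoms Kk Kc.
suff -> : k = k' by [].
have := block_side k q; rewrite -IK side_ancestor; last by case: (s_dyadic Is).
have [_ ->] := s_dyadic Is => /mulIf; rewrite gt_eqF // => /(_ isT) /ieexprIn.
by move=> -> //; rewrite gt_eqF // ltr1n.
Qed.

Lemma kernel_akernel k q p x y : block k q \in Ks ->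
  cube_set (acube q) x -> cube_set (acube p) y ->
  kernel (block k q) x y = akernel k q p.
Proof.
move=> Kk qx py; rewrite /akernel Kk.
have /andP[] := Ks_level Kk; rewrite gtn_max => /andP[uk vk] _.
have side_eq w (r : atom) : (w < k)%N ->
    side (block k q) = 2 ^+ w.+1 * side (block (k - w.+1) r).
  by move=> wk; rewrite !block_side mulrA -exprD subnKC.
transitivity (kernel (block k q) (corner (acube q)) y).
  apply: (@kernel_const_x _ _ beta cN h u v a haar _ (block (k - v.+1) q)).
  - exact: block_dyadic.
  - exact: side_eq.
  - exact: acube_sub qx.
  - exact: acube_sub (corner_acube q).
apply: (@kernel_const_y _ _ beta cN h u v a haar _ (block (k - u.+1) p)).
- exact: block_dyadic.
- exact: side_eq.
- exact: acube_sub py.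
- exact: acube_sub (corner_acube p).
Qed.

Lemma component_atoms f k q x : (k <= n)%N -> atom_integrable f ->
  cube_set (acube q) x ->
  component (block k q) f x = m^-1 * level_op block d akernel k (atom_int f) q.
Proof.
move=> kn fint qx; have [Kk|nKk] := boolP (block k q \in Ks); last first.
  rewrite Ks_supp //; last exact: block_dyadic.
  rewrite /level_op big1 ?mul0r ?mulr0 // => p _.
  by rewrite /akernel (negbTE nKk) mul0r.
rewrite /shift_component block_volume /level_op invfM.
suff -> : \int[mu]_(y in cube_set (block k q)) (kernel (block k q) x y * f y) =
    \sum_(p | block k q == block k p) akernel k q p * atom_int f p by ring.
have -> : \int[mu]_(y in cube_set (block k q)) (kernel (block k q) x y * f y) =
    \int[mu]_y (kernel (block k q) x y * f y).
  rewrite Rintegral_mkcond; apply: eq_Rintegral => y _; rewrite patchE.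
  case: ifPn => // /negP Ky; rewrite (@kernel_out_y _ _ beta cN h u v a haar) ?mul0r //.
  by move=> /mem_set.
rewrite /Rintegral (@integral_atoms _ _
  (fun p => if block k q == block k p then akernel k q p else 0)) //=.
- rewrite [RHS]big_mkcond; apply: eq_bigr => p _.
  by case: ifP; rewrite ?mul0r.
- move=> p y py; case: eqP => [_|ne]; first exact: kernel_akernel.
  by apply: (@kernel_out_y _ _ beta cN h u v a haar) => /(block_mem k q py).
- move=> y ny; apply: (@kernel_out_y _ _ beta cN h u v a haar).
  by move=> /(atom_cover kn)[p]; exact: ny.
Qed.

(** On an atom the shift is the discrete shift of the integrals over the atoms;
    each point lies in exactly one cube of each level. *)
Lemma dyadic_shift_atoms f q x : atom_integrable f -> cube_set (acube q) x ->
  dyadic_shift D h u v a f x = m^-1 * trunc_shift block d akernel n (atom_int f) q.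
Proof.
move=> fint qx; rewrite /trunc_shift mulr_sumr.
have block_linj k k' : block k q = block k' q -> k = k'.
  move=> /(congr1 (@side R N)); rewrite !block_side => /mulIf.
  rewrite gt_eqF // => /(_ isT) /ieexprIn; by move=> -> //; rewrite gt_eqF // ltr1n.
rewrite /dyadic_shift (fsbigE [seq block k q | k <- index_iota 1 n.+1]).
- rewrite big_map big_mkcond; apply: eq_big_nat => k /andP[_ kn].
  rewrite mem_set; last exact: block_dyadic.
  exact: component_atoms.
- by rewrite map_inj_uniq ?iota_uniq // => k k'; exact: block_linj.
- by move=> K /mapP[k _ ->]; exact: block_dyadic.
- move=> K DK; apply: contraNeq => cK; have [Kx|nKx] := pselect (cube_set K x); last first.
    by rewrite (@component_out_x _ _ beta cN h u v a haar) ?eqxx in cK.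
  have KKs : K \in Ks.
    by apply: contraNT cK => nKs; rewrite (Ks_supp DK nKs).
  have [I [k [Is /andP[uvk kn] IK Ix]]] := Ks_atoms KKs Kx.
  apply/mapP; exists k.
    by rewrite mem_index_iota ltnS kn (leq_ltn_trans _ uvk).
  by rewrite -IK -(acube_disj (p := SeqSub Is) _ qx).
Qed.

Lemma dyadic_shift_out f x : (forall q, ~ cube_set (acube q) x) ->
  dyadic_shift D h u v a f x = 0.
Proof.
move=> nx; apply: fsbig1 => K DK.
have [KKs|nKs] := boolP (K \in Ks); last by rewrite Ks_supp.
apply: (@component_out_x _ _ beta cN h u v a haar) => Kx.
have [I [k [Is _ _ Ix]]] := Ks_atoms KKs Kx.
exact: (nx (SeqSub Is)).
Qed.

Section Estimate.
Variable C0 : R.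
Hypotheses (C0_ge0 : 0 <= C0) (S_norm : normalized_shift D h u v a C0)
  (S_L2 : bounded_shift D h u v a C0).

Local Notation S := (dyadic_shift D h u v a).
Local Notation T := (trunc_shift block d akernel n).

Lemma L2norm_atoms (sg phi : 'rV[R]_N -> R) (b : atom -> R) :
  (forall q x, cube_set (acube q) x -> phi x = b q) ->
  (forall x, (forall q, ~ cube_set (acube q) x) -> phi x = 0) ->
  atom_integrable sg ->
  L2norm sg phi = ((\sum_q b q ^+ 2 * atom_int sg q)%:E `^ 2^-1)%E.
Proof.
move=> phib phi0 sgi; rewrite /L2norm; congr (_ `^ _)%E.
apply: integral_atoms => // [q x qx|x nx].
  by rewrite (phib q) // real_normK ?num_real.
by rewrite phi0 // normr0 expr0n.
Qed.

Definition step (psi : atom -> R) x := \sum_q psi q * \1_(cube_set (acube q)) x.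

Lemma step_in psi q x : cube_set (acube q) x -> step psi x = psi q.
Proof.
move=> qx; rewrite /step (bigD1 q) //= big1 ?addr0 => [|p pq].
  by rewrite indicE mem_set ?mulr1.
rewrite indicE memNset ?mulr0 // => px; move/eqP: pq; apply.
exact: acube_disj px qx.
Qed.

Lemma step_out psi x : (forall q, ~ cube_set (acube q) x) -> step psi x = 0.
Proof. by move=> nx; rewrite /step big1 // => p _; rewrite indicE memNset ?mulr0. Qed.

Lemma measurable_step psi : measurable_fun setT (step psi).
Proof.
apply: measurable_sum => q; apply: measurable_funM; first exact: measurable_cst.
by apply: measurable_indic; exact: measurable_cube_set.
Qed.

Lemma step_integrable psi : atom_integrable (step psi).
Proof.
move=> q; apply: (eq_integrable (measurable_cube_set _) (EFin \o cst (psi q))).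
  by move=> x /set_mem qx /=; rewrite (step_in _ qx).
exact: integrable_cst.
Qed.

Lemma atom_int_cst r q : atom_int (cst r) q = r * m.
Proof.
rewrite /atom_int Rintegral_cst; last exact: measurable_cube_set.
by rewrite [X in _ * fine X](mu_acube q).
Qed.

Lemma atom_int_step psi q : atom_int (step psi) q = psi q * m.
Proof.
rewrite -(atom_int_cst _ q); apply: eq_Rintegral => x /set_mem qx.
by rewrite (step_in _ qx).
Qed.

Lemma sqrt_bound (x y c : R) : 0 <= x -> 0 <= y -> 0 <= c ->
  (x%:E `^ 2^-1 <= c%:E * y%:E `^ 2^-1)%E -> x <= c ^+ 2 * y.
Proof.
move=> x0 y0 c0; rewrite !poweR_EFin !powR12_sqrt // -EFinM lee_fin => H.
rewrite -(sqr_sqrtr x0) -(sqr_sqrtr y0) -exprMn ler_sqr ?nnegrE //.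
by rewrite mulr_ge0 // sqrtr_ge0.
Qed.

(** The discrete L^2 bound is the given one, tested on step functions. *)
Lemma trunc_shift_L2 psi : \sum_q T psi q ^+ 2 <= C0 ^+ 2 * \sum_q psi q ^+ 2.
Proof.
pose f := step (fun p => psi p / m).
have fint : atom_integrable f by exact: step_integrable.
have f_int : atom_int f = psi.
  by apply/funext => q; rewrite atom_int_step divfK // gt_eqF.
have one_int : atom_integrable (cst 1) by move=> p; exact: integrable_cst.
have fnorm : L2norm (cst 1) f = ((m^-1 * \sum_q psi q ^+ 2)%:E `^ 2^-1)%E.
  rewrite (@L2norm_atoms _ _ (fun p => psi p / m)) //; last 2 first.
  - by move=> q x qx; rewrite /f (step_in _ qx).
  - by move=> x nx; rewrite /f step_out.
  rewrite mulr_sumr; congr (_%:E `^ _)%E; apply: eq_bigr => q _.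
  by rewrite atom_int_cst; field; rewrite gt_eqF.
have Snorm : L2norm (cst 1) (S f) = ((m^-1 * \sum_q T psi q ^+ 2)%:E `^ 2^-1)%E.
  rewrite (@L2norm_atoms _ _ (fun p => m^-1 * T psi p)) //; last 2 first.
  - by move=> q x qx; rewrite (dyadic_shift_atoms fint qx) f_int.
  - by move=> x nx; rewrite dyadic_shift_out.
  rewrite mulr_sumr; congr (_%:E `^ _)%E; apply: eq_bigr => q _.
  by rewrite atom_int_cst; field; rewrite gt_eqF.
have := @S_L2 f; rewrite fnorm Snorm => /(_ _).
have f_L2 : in_L2 f.
  split; first exact: measurable_step.
  by rewrite fnorm poweR_lty // ltry.
move=> /(_ f_L2) /sqrt_bound; rewrite mulrCA ler_pM2l ?invr_gt0 //; apply => //.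
  by rewrite mulr_ge0 ?invr_ge0 ?(ltW m_gt0) // sumr_ge0 // => q _; rewrite sqr_ge0.
by rewrite mulr_ge0 ?invr_ge0 ?(ltW m_gt0) // sumr_ge0 // => q _; rewrite sqr_ge0.
Qed.

Lemma akernel_le k q p : `|akernel k q p| <= C0.
Proof.
rewrite /akernel; case: ifP => _; last by rewrite normr0.
by apply: S_norm; exact: block_dyadic.
Qed.

Lemma akernel_constr k q p p' : block k q = block k p ->
  block (k - u.+1) p = block (k - u.+1) p' -> akernel k q p = akernel k q p'.
Proof.
move=> qp pp; have [Kk|nKk] := boolP (block k q \in Ks); last first.
  by rewrite /akernel (negbTE nKk).
have /andP[] := Ks_level Kk; rewrite gtn_max => /andP[uk _] _.
have qp' : block k q = block k p'.
  by rewrite qp; apply: (@block_le _ _ _ block_nested (k - u.+1)) => //; exact: leq_subr.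
rewrite /akernel Kk.
apply: (@kernel_const_y _ _ beta cN h u v a haar _ (block (k - u.+1) p)).
- exact: block_dyadic.
- by rewrite !block_side mulrA -exprD subnKC.
- exact: acube_sub (corner_acube p).
- by rewrite pp; exact: acube_sub (corner_acube p').
Qed.

Lemma akernel_constl k q q' p : block k p = block k q ->
  block (k - v.+1) q = block (k - v.+1) q' -> akernel k q p = akernel k q' p.
Proof.
move=> qp qq.
have qq' : block k q = block k q'.
  by apply: (@block_le _ _ _ block_nested (k - v.+1)) => //; exact: leq_subr.
rewrite /akernel -qq'; case: ifP => // Kk.
have /andP[] := Ks_level Kk; rewrite gtn_max => /andP[_ vk] _.
apply: (@kernel_const_x _ _ beta cN h u v a haar _ (block (k - v.+1) q)).
- exact: block_dyadic.
- by rewrite !block_side mulrA -exprD subnKC.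
- exact: acube_sub (corner_acube q).
- by rewrite qq; exact: acube_sub (corner_acube q').
Qed.

Variables (w : 'rV[R]_N -> R) (A : R).
Hypotheses (w_meas : measurable_fun setT w) (w_gt0 : forall x, 0 < w x).
Hypothesis w_cube : forall Q : cube, mu.-integrable (cube_set Q) (EFin \o w).
Hypotheses (A2_eq : A2_norm w = A%:E) (N_gt0 : (0 < N)%N).

Let sigma x := (w x)^-1.

Lemma trunc_shift_scale (t : R) psi q : T (fun p => t * psi p) q = t * T psi q.
Proof.
by rewrite /trunc_shift mulr_sumr; apply: eq_bigr => k _; rewrite level_op_scale.
Qed.

(** The weights of the discrete problem are the averages of w and 1/w over the
    atoms, and the function is the average of 1_Q with respect to w. *)
Theorem shift_testing (Q : cube) :
  (L2norm sigma (S (fun x => w x * \1_(cube_set Q) x)%R) <=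
   (8 * tree_const d C0 u v * A)%:E *
   (\int[mu]_(x in cube_set Q) (w x)%:E) `^ 2^-1)%E.
Proof.
have A2_fin : (A2_norm w < +oo)%E by rewrite A2_eq ltry.
have A_gt0 : 0 < A.
  by apply: (@lt_le_trans _ _ 1) => //; rewrite -lee_fin -A2_eq A2_norm_ge1.
have s_gt0 q : 0 < side (acube q) by rewrite acube_side.
have w_int : atom_integrable w by move=> q; exact: w_cube.
have sg_int : atom_integrable sigma by move=> q; exact: inv_weight_integrable.
have w_int0 q : 0 < atom_int w q by exact: weight_Rint_gt0.
have vol_atom q : volume (acube q) = m by rewrite volume_cube acube_side // ltW.
have w_sg q : m ^+ 2 <= atom_int w q * atom_int sigma q.
  by rewrite -(vol_atom q); exact: weight_AM_GM.
have sg_int0 q : 0 < atom_int sigma q.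
  rewrite -(pmulr_rgt0 _ (w_int0 q)); apply: lt_le_trans (w_sg q).
  exact: exprn_gt0.
pose W q := atom_int w q / m; pose sg q := atom_int sigma q / m.
have avg_int k q f : (k <= n)%N -> atom_integrable f ->
    avg block d k (fun p => atom_int f p / m) q =
    (volume (block k q))^-1 * \int[mu]_(x in cube_set (block k q)) f x.
  move=> kn fi; rewrite /Rintegral (integral_block q kn fi) /= block_volume.
  rewrite /avg {1}/block_sum -mulr_suml -/(block_sum block k (atom_int f) q).
  by rewrite invfM; ring.
pose f x := w x * \1_(cube_set Q) x.
have f_ge0 x : 0 <= f x by rewrite mulr_ge0 // ltW.
have f_le x : f x <= w x.
  by rewrite ler_piMr ?(ltW (w_gt0 x)) // indicE; case: (x \in _).
have f_meas : measurable_fun setT f.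
  apply: measurable_funM => //.
  by apply: measurable_indic; exact: measurable_cube_set.
have f_int : atom_integrable f.
  move=> q; apply: (le_integrable (measurable_cube_set _) _ _ (w_int q)).
    by apply/measurable_EFinP; exact: measurable_funTS.
  move=> x _; rewrite /= lee_fin !ger0_norm //; exact: ltW.
have F_ge0 q : 0 <= atom_int f q by apply: Rintegral_ge0.
have F_le q : atom_int f q <= atom_int w q.
  by apply: le_Rintegral => //; exact: measurable_cube_set.
pose fd q := atom_int f q / atom_int w q.
have fd_ge0 q : 0 <= fd q by rewrite divr_ge0 // ltW.
have fd_le1 q : fd q <= 1 by rewrite ler_pdivrMr // mul1r.
(* The discrete weighted bound applies to W fd, while the integrals of f over the
   atoms are m W fd, where m is the volume of an atom. *)
have F_E : atom_int f = fun p => m * (W p * fd p).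
  apply/funext => p; rewrite /W /fd; field.
  by rewrite !gt_eqF.
set K := 8 * tree_const d C0 u v * A.
have d_ge2 : 2 <= d by rewrite ler_eXnr // ler1n.
have K_ge0 : 0 <= K.
  by rewrite mulr_ge0 ?(ltW A_gt0) // mulr_ge0 // ltW // tree_const_gt0.
have discrete : \sum_q sg q * T (fun p => W p * fd p) q ^+ 2 <=
    K ^+ 2 * \sum_p W p * fd p ^+ 2.
  apply: (shift_A2_bound block_inj block_nested) => //.
  - by move=> k q kn; exact: block_card.
  - exact: akernel_le.
  - exact: trunc_shift_L2.
  - exact: akernel_constr.
  - exact: akernel_constl.
  - by move=> q; rewrite divr_gt0.
  - by move=> q; rewrite divr_gt0.
  - move=> q; rewrite /W /sg mulrACA -invfM -expr2 ler_pdivlMr ?exprn_gt0 //.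
    by rewrite mul1r.
  - move=> k q kn; rewrite !avg_int // -lee_fin -A2_eq; apply: A2_average => //.
    by rewrite block_side mulr_gt0 ?exprn_gt0.
have sum_F : \sum_q atom_int f q <= \int[mu]_(x in cube_set Q) w x.
  rewrite -lee_fin [in leRHS]/Rintegral fineK ?weight_fin //.
  have -> : (\int[mu]_(x in cube_set Q) (w x)%:E = \int[mu]_x (f x)%:E)%E.
    rewrite integral_mkcond; apply: eq_integral => x _; rewrite patchE /f indicE.
    by case: ifP => _; rewrite ?mulr1 ?mulr0.
  have := @integral_atoms (step (fun=> 1)) f (fun=> 1) _ _ f_int.
  under eq_bigr do rewrite mul1r.
  move=> <-; [|by move=> q x qx; rewrite (step_in _ qx)|by move=> x nx; rewrite step_out].
  have step01 x : 0 <= step (fun=> 1) x <= 1.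
    have [[q qx]|nx] := pselect (exists q, cube_set (acube q) x).
      by rewrite (step_in _ qx) ler01 lexx.
    by rewrite step_out ?lexx ?ler01 // => q qx; apply: nx; exists q.
  apply: ge0_le_integral => //.
  - by move=> x _; rewrite lee_fin mulr_ge0 //; case/andP: (step01 x).
  - by apply/measurable_EFinP; apply: measurable_funM => //; exact: measurable_step.
  - exact/measurable_EFinP.
  - by move=> x _; rewrite lee_fin ler_piMl //; case/andP: (step01 x).
rewrite (@L2norm_atoms sigma _ (T (fun p => W p * fd p))) //; last 2 first.
- move=> q x qx; rewrite (dyadic_shift_atoms f_int qx) F_E trunc_shift_scale mulKf //.
  by rewrite gt_eqF.
- by move=> x nx; rewrite dyadic_shift_out.
rewrite -(fineK (weight_fin w_cube Q)) //= -EFinM lee_fin.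
set I := fine _; have I0 : 0 <= I.
  by rewrite fine_ge0 //; apply: integral_ge0 => x _; rewrite lee_fin ltW.
have N0 : 0 <= \sum_q T (fun p => W p * fd p) q ^+ 2 * atom_int sigma q.
  by apply: sumr_ge0 => q _; rewrite mulr_ge0 ?sqr_ge0 // ltW.
rewrite !powR12_sqrt // -[K]ger0_norm // -sqrtr_sqr -sqrtrM ?sqr_ge0 //.
apply: ler_wsqrtr.
apply: (@le_trans _ _ (m * (K ^+ 2 * \sum_p W p * fd p ^+ 2))).
  have -> : \sum_q T (fun p => W p * fd p) q ^+ 2 * atom_int sigma q =
      m * \sum_q sg q * T (fun p => W p * fd p) q ^+ 2.
    rewrite mulr_sumr; apply: eq_bigr => q _; rewrite /sg; field.
    by rewrite gt_eqF.
  by rewrite ler_pM2l.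
rewrite mulrCA ler_wpM2l ?sqr_ge0 //; apply: le_trans sum_F.
rewrite mulr_sumr; apply: ler_sum => q _.
have -> : m * (W q * fd q ^+ 2) = atom_int f q * fd q.
  by rewrite /W /fd; field; rewrite !gt_eqF.
by rewrite ler_piMr.
Qed.

Lemma atom_integrable_cut (f : 'rV[R]_N -> R) (Q : cube) :
  measurable_fun setT f -> atom_integrable f ->
  atom_integrable (fun x => f x * \1_(cube_set Q) x).
Proof.
move=> f_meas fi q; apply: (le_integrable (measurable_cube_set _) _ _ (fi q)).
  apply/measurable_EFinP/measurable_funTS; apply: measurable_funM => //.
  by apply: measurable_indic; exact: measurable_cube_set.
by move=> x _; rewrite /= lee_fin normrM ler_piMr // ger0_norm // indicE.
Qed.

(** Only the integrals of the weight and of its inverse over the atoms enter,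
    so a weight that is positive almost everywhere may be replaced by one that
    is positive everywhere. *)
Theorem shift_testing_ae (w0 : 'rV[R]_N -> R) (Q : cube) :
  measurable_fun setT w0 -> {ae mu, forall x, w0 x = w x} ->
  (L2norm (fun x => (w0 x)^-1)%R (S (fun x => w0 x * \1_(cube_set Q) x)%R) <=
   (8 * tree_const d C0 u v * A)%:E *
   (\int[mu]_(x in cube_set Q) (w0 x)%:E) `^ 2^-1)%E.
Proof.
move=> w0_meas w0w.
have A2_fin : (A2_norm w < +oo)%E by rewrite A2_eq ltry.
have w0_cube (P : cube) :=
  ae_eq_integrable (measurable_cube_set P) w0_meas w_meas w0w (w_cube P).
have s_gt0 q : 0 < side (acube q) by rewrite acube_side.
have w0i : atom_integrable w0 by move=> q; case: (w0_cube (acube q)).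
have wi : atom_integrable w by move=> q; exact: w_cube.
have w0iw : {ae mu, forall x, (w0 x)^-1 = (w x)^-1} by apply: filterS w0w => x ->.
have inv_cube q := ae_eq_integrable (measurable_cube_set (acube q))
  (measurable_inv w0_meas) (measurable_inv w_meas) w0iw
  (inv_weight_integrable w_meas w_gt0 A2_fin (s_gt0 q)).
have S_eq : S (fun x => w0 x * \1_(cube_set Q) x) =
    S (fun x => w x * \1_(cube_set Q) x).
  apply/funext => x.
  have [[q qx]|nx] := pselect (exists q, cube_set (acube q) x); last first.
    by rewrite !dyadic_shift_out // => q qx; apply: nx; exists q.
  have fi := atom_integrable_cut Q w_meas wi.
  have fi0 := atom_integrable_cut Q w0_meas w0i.
  rewrite (dyadic_shift_atoms fi qx) (dyadic_shift_atoms fi0 qx).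
  congr (_ * T _ q); apply/funext => p; rewrite /atom_int /Rintegral.
  congr fine; apply: ae_eq_integral; first exact: measurable_cube_set.
  - by case/integrableP: (fi0 p).
  - by case/integrableP: (fi p).
  - by apply: filterS w0w => y /= -> _.
have L2_eq phi (b : atom -> R) : (forall q x, cube_set (acube q) x -> phi x = b q) ->
    (forall x, (forall q, ~ cube_set (acube q) x) -> phi x = 0) ->
    L2norm (fun x => (w0 x)^-1) phi = L2norm sigma phi.
  move=> phib phi0; rewrite !(L2norm_atoms phib phi0).
  - congr (_%:E `^ _)%E; apply: eq_bigr => q _; congr (_ * fine _).
    by case: (inv_cube q).
  - by move=> q; exact: inv_weight_integrable.
  - by move=> q; case: (inv_cube q).
have [_ ->] := w0_cube Q; rewrite S_eq.
rewrite (L2_eq _ (fun q => m^-1 * T (atom_int (fun x => w x * \1_(cube_set Q) x)) q)).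
- exact: shift_testing.
- by move=> q x qx; rewrite (dyadic_shift_atoms _ qx) //; exact: atom_integrable_cut.
- by move=> x nx; rewrite dyadic_shift_out.
Qed.

End Estimate.

End ShiftOnAtoms.

End Discretization.

(** * Degenerate parameters and weights positive almost everywhere *)

Section Goodness.
Variables (R : realType) (N : nat) (beta : int -> 'I_N -> bool).
Local Notation cube := (cube R N).
Local Notation D := (@dyadic_system R N beta).
Hypothesis N_gt0 : (0 < N)%N.

Lemma corner_boundary (I : cube) : 0 < side I -> boundary (cube_set I) (corner I).
Proof.
move=> s0; split; first by apply: subset_closure; exact: corner_in.
rewrite /interior /= => /nbhs_ballP[e /= e0 ball_sub].
have /ball_sub/(_ (Ordinal N_gt0)) : ball (corner I) e (corner I - const_mx (e / 2)).
  split=> // i j; rewrite !mxE /ball /= opprB addrC subrK.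
  rewrite ger0_norm; last by rewrite divr_ge0 // ltW.
  by rewrite ltr_pdivrMr // ltr_pMr // ltr1n.
rewrite !mxE; lra.
Qed.

Lemma set_dist_le0 (A B : set 'rV[R]_N) x : A x -> B x -> set_dist A B <= 0.
Proof.
move=> Ax Bx; apply: ge_inf.
  by exists 0 => _ [y _ [z _ <-]]; exact: sqrtr_ge0.
exists x => //; exists x => //.
rewrite subrr /euclidean_norm big1 ?sqrtr0 // => i _.
by rewrite mxE expr0n.
Qed.

Lemma descendants0 (K I : cube) : D K -> descendants D 0 K I -> I = K.
Proof.
move=> DK [DI IK sI]; apply: (@dyadic_eq _ _ beta _ _ (corner I)) => //.
- by rewrite sI expr0 invr1 mul1r.
- exact: corner_in (dyadic_side_gt0 DI).
- by apply: IK; exact: corner_in (dyadic_side_gt0 DI).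
Qed.

(** A cube touches its own boundary, so goodness leaves no coefficients at all
    when one of the two parameters vanishes. *)
Lemma good_shift_degenerate h u v a gamma (f : 'rV[R]_N -> R) :
  good_shift D u v a gamma -> u = 0%N \/ v = 0%N ->
  dyadic_shift D h u v a f = fun=> 0.
Proof.
move=> good uv0; apply/funext => x; apply: fsbig1 => K DK.
have K0 := dyadic_side_gt0 DK.
have a0 I J eta theta : descendants D u K I -> descendants D v K J ->
    a I J K eta theta = 0.
  move=> uI vJ; apply: contrapT => aN0.
  have [distJ distI] := good K I J DK uI vJ (ex_intro _ eta (ex_intro _ theta aN0)).
  have pos (L : cube) : D L -> 0 < 2^-1 * side L `^ gamma * side K `^ (1 - gamma).
    by move=> /dyadic_side_gt0 L0; rewrite !mulr_gt0 ?powR_gt0.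
  have dist0 : set_dist (cube_set K) (boundary (cube_set K)) <= 0.
    exact: set_dist_le0 (corner_in K0) (corner_boundary K0).
  case: uv0 => uv0.
    have IK : I = K by apply: (descendants0 DK); rewrite -uv0.
    rewrite IK in distI.
    by have := lt_le_trans (pos K DK) (le_trans distI dist0); rewrite ltxx.
  have JK : J = K by apply: (descendants0 DK); rewrite -uv0.
  rewrite JK in distJ.
  by have := lt_le_trans (pos K DK) (le_trans distJ dist0); rewrite ltxx.
rewrite /shift_component (@eq_Rintegral _ _ _ _ _ (fun=> 0)); last first.
  move=> y _; rewrite /shift_kernel fsbig1 ?mul0r // => I uI; apply: fsbig1 => J vJ.
  by apply: big1 => eta _; apply: big1 => theta _; rewrite a0 ?mul0r.
by rewrite Rintegral_cst ?mul0r ?mulr0 //; exact: measurable_cube_set.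
Qed.

End Goodness.

Section PositivePart.
Variables (R : realType) (N : nat) (w : 'rV[R]_N -> R).
Local Notation mu := (@lebesgue_rV R N).
Hypothesis w_weight : weight w.

Definition positive_version x : R := if 0 < w x then w x else 1.
Local Notation w' := positive_version.

Lemma positive_version_gt0 x : 0 < w' x.
Proof. by rewrite /positive_version; case: ifP. Qed.

Lemma measurable_positive_version : measurable_fun setT w'.
Proof.
have [[w_meas _] _] := w_weight.
apply: measurable_fun_ifT => //.
by apply: measurable_fun_ltr.
Qed.

Lemma positive_version_ae : {ae mu, forall x, w x = w' x}.
Proof.
have [_ w_pos] := w_weight.
by apply: filterS w_pos => x w0; rewrite /positive_version w0.
Qed.

Lemma positive_version_integrable (Q : cube R N) :
  mu.-integrable (cube_set Q) (EFin \o w').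
Proof.
have [w_loc _] := w_weight; have [w_meas _] := w_loc.
have := ae_eq_integrable (mu := mu) (measurable_cube_set Q) measurable_positive_version
  w_meas _ (locally_integrable_cube Q w_loc).
case => //; by apply: filterS positive_version_ae => x ->.
Qed.

Lemma positive_version_A2 : A2_norm w' = A2_norm w.
Proof.
have [[w_meas _] _] := w_weight.
have int_eq (f g : 'rV[R]_N -> R) (Q : cube R N) : measurable_fun setT f ->
    measurable_fun setT g -> {ae mu, forall x, f x = g x} ->
    (\int[mu]_(x in cube_set Q) (f x)%:E = \int[mu]_(x in cube_set Q) (g x)%:E)%E.
  move=> fm gm fg; apply: ae_eq_integral; first exact: measurable_cube_set.
  - by apply/measurable_EFinP; exact: measurable_funTS.
  - by apply/measurable_EFinP; exact: measurable_funTS.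
  - by apply: filterS fg => x -> _.
rewrite /A2_norm; congr ereal_sup; apply: eq_imagel => Q _.
congr (_ * _ * (_ * _))%E; apply/esym; apply: int_eq => //.
- exact: measurable_positive_version.
- exact: positive_version_ae.
- exact: measurable_inv.
- by apply: measurable_inv; exact: measurable_positive_version.
- by apply: filterS positive_version_ae => x ->.
Qed.

End PositivePart.

(** For nonzero u and v the linear growth in u and v is absorbed by the product. *)
Lemma tree_const_le (R : realType) (d C0 : R) u v : 1 <= d -> 0 <= C0 ->
  (0 < u)%N -> (0 < v)%N ->
  tree_const d C0 u v <= tree_const d C0 1 1 * (u%:R * v%:R).
Proof.
move=> d1 C0_ge0 u0 v0; rewrite /tree_const.
have u1 : 1 <= u%:R :> R by rewrite ler1n.
have v1 : 1 <= v%:R :> R by rewrite ler1n.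
have d0 : 0 <= d by exact: le_trans d1.
have x0 : 0 <= 8 * C0 by rewrite mulr_ge0.
have y0 : 0 <= 8 * C0 * d by rewrite mulr_ge0.
have z0 : 0 <= 32 * d ^+ 2 * L2_const C0.
  rewrite mulr_ge0 ?mulr_ge0 ?exprn_ge0 // /L2_const.
  by have := sqr_ge0 C0; lra.
set x := 8 * C0 in x0 *; set y := x * d in y0 *; set z := 32 * _ * _ in z0 *.
rewrite !mulr1 [leRHS]mulrDl [X in _ <= X + _]mulrDl.
apply: lerD; first apply: lerD.
- by rewrite ler_wpM2l // ler_peMr // ler0n.
- by rewrite ler_wpM2l // ler_peMl // ler0n.
- by rewrite ler_peMr // -[leLHS]mulr1 ler_pM // ler01.
Qed.

Theorem theorem6p1 (R : realType) (N : nat) (alpha C0 cN : R)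
    (N_gt0 : (0 < N)%N) (alpha_bounds : 0 < alpha <= 1) :
  let gamma := alpha / (2 * (N%:R + alpha)) in
  exists C : R,
  forall (beta : int -> 'I_N -> bool)
    (h : cube R N -> haar_index N -> 'rV[R]_N -> R)
    (u v : nat)
    (a : cube R N -> cube R N -> cube R N ->
         haar_index N -> haar_index N -> R)
    (w : 'rV[R]_N -> R),
  let D := dyadic_system beta in
  let sigma := fun x => (w x)^-1 in
  let S := dyadic_shift D h u v a in
  (forall I, D I -> haar_functions cN I (h I)) ->
  normalized_shift D h u v a C0 ->
  good_shift D u v a gamma ->
  finite_shift D h u v a ->
  bounded_shift D h u v a C0 ->
  weight w ->
  (A2_norm w < +oo)%E ->
  (forall Q : cube R N, 0 < side Q ->
    (L2norm sigma (S (fun x => w x * \1_(cube_set Q) x)%R)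
      <= (C * 2 `^ ((maxn u v)%:R * gamma * N%:R / 2) * u%:R * v%:R)%:E
         * A2_norm w
         * (\int[lebesgue_rV]_(x in cube_set Q) (w x)%:E) `^ 2^-1)%E) /\
  (forall Q : cube R N, D Q ->
    (L2norm sigma (S (fun x => w x * \1_(cube_set Q) x)%R)
      <= (C * u%:R * v%:R)%:E
         * A2_norm w
         * (\int[lebesgue_rV]_(x in cube_set Q) (w x)%:E) `^ 2^-1)%E).
Proof.
move=> gamma; pose d : R := 2 ^+ N; pose C : R := 8 * tree_const d `|C0| 1 1.
exists C => beta h u v a w D sigma S haar S_norm good S_fin S_L2 w_weight A2_fin.
have d_ge2 : 2 <= d by rewrite ler_eXnr // ler1n.
have C_ge0 : 0 <= C by rewrite mulr_ge0 // ltW // tree_const_gt0.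
have A2_eq := positive_version_A2 w_weight.
have w'_meas := measurable_positive_version w_weight.
have w'_gt0 := @positive_version_gt0 _ _ w.
have w'_cube := positive_version_integrable w_weight.
have w'_fin : (A2_norm (positive_version w) < +oo)%E by rewrite A2_eq.
have A2_ge1 : (1 <= A2_norm w)%E by rewrite -A2_eq; exact: A2_norm_ge1.
have A2_ge0 : (0 <= A2_norm w)%E by exact: le_trans A2_ge1.
have A2_num : A2_norm w = (fine (A2_norm w))%:E by rewrite fineK // ge0_fin_numE.
have bound (Q : cube R N) : 
    (L2norm sigma (S (fun x => w x * \1_(cube_set Q) x)%R)
      <= (C * u%:R * v%:R)%:E * A2_norm w
         * (\int[lebesgue_rV]_(x in cube_set Q) (w x)%:E) `^ 2^-1)%E.
  have rhs_ge0 : (0 <= (C * u%:R * v%:R)%:E * A2_norm w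
         * (\int[lebesgue_rV]_(x in cube_set Q) (w x)%:E) `^ 2^-1)%E.
    apply: mule_ge0; last exact: poweR_ge0.
    by apply: mule_ge0 => //; rewrite lee_fin mulr_ge0 // mulr_ge0.
  have [uv0|] := pselect (u = 0%N \/ v = 0%N).
    apply: le_trans rhs_ge0; rewrite /S (good_shift_degenerate N_gt0 _ _ good uv0).
    rewrite /L2norm integral0_eq ?poweR0r ?invr_eq0 // => x _.
    by rewrite normr0 expr0n mul0r.
  move=> /not_orP[/eqP + /eqP]; rewrite -!lt0n => u0 v0.
  have [I0 DI0] : exists I, D I.
    exists (\row_i (2 ^ (- 0) * (0 : int)%:~R + dyadic_offset beta (2 ^ (- 0)) ord0 i),
      2 ^ (- 0)).
    by apply/dyadic_systemP; exists 0, (fun=> 0); split => // i; rewrite /corner /= mxE.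
  have C0_ge0 : 0 <= C0 by exact: le_trans (S_norm I0 DI0 0 0).
  have /finite_seqP[Ks KsE] := S_fin.
  have KsP K : K \in Ks <-> D K /\ shift_component D h u v a K <> (fun _ _ => 0).
    by rewrite -[X in _ <-> X]/([set K | _ /\ _] K) KsE.
  have DKs K : K \in Ks -> D K by move=> /KsP[].
  have Ks_supp K : D K -> K \notin Ks -> shift_component D h u v a K = fun _ _ => 0.
    by move=> DK; apply: contraNP => cK; apply/KsP.
  have [s [s0 [n [s0_gt0 s_dyadic s_closed s_atoms]]]] := atoms_ex (maxn u v) DKs.
  have [[w_meas _] _] := w_weight.
  have := @shift_testing_ae R N beta s s0 n s0_gt0 s_dyadic s_closed cN h u v a haar
    Ks Ks_supp s_atoms C0 C0_ge0 S_norm S_L2 (positive_version w) (fine (A2_norm w))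
    w'_meas w'_gt0 w'_cube _ N_gt0 w Q w_meas (positive_version_ae w_weight).
  rewrite A2_eq => /(_ A2_num) /le_trans; apply.
  apply: lee_wpmul2r; first exact: poweR_ge0.
  rewrite EFinM -A2_num; apply: lee_wpmul2r => //.
  rewrite lee_fin /C -!mulrA ler_wpM2l // ger0_norm //.
  by apply: tree_const_le => //; apply: le_trans d_ge2; rewrite ler1n.
split=> Q _; last exact: bound.
apply: le_trans (bound Q) _.
apply: lee_wpmul2r; first exact: poweR_ge0.
apply: lee_wpmul2r => //; rewrite lee_fin.
rewrite -[leRHS]mulrA -[leLHS]mulrA ler_wpM2r ?mulr_ge0 // ler_peMr //.
rewrite -[leLHS](powRr0 2); apply: ler_powR; first by rewrite ler1n.
have /andP[alpha_gt0 _] := alpha_bounds.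
have gamma_ge0 : 0 <= gamma.
  by rewrite divr_ge0 ?(ltW alpha_gt0) // mulr_ge0 // addr_ge0 // ltW.
by rewrite divr_ge0 // mulr_ge0 // mulr_ge0.
Qed.
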